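(* Let $d\ge 2$ and let $A\subset\mathbb{R}^d$ be an uncountable Borel set. Then there exists a compact set $E\subset\mathbb{R}^d$ of $d$-dimensional Lebesgue measure zero that contains, in every direction, a unit line segment whose center lies in $A$; that is, for every $e\in S^{d-1}$ there exists $a\in A$ such that $\{a+te : t\in[-\tfrac12,\tfrac12]\}\subset E$.
   Context: A unit line segment in direction $e\in S^{d-1}$ (the unit sphere of $\mathbb{R}^d$) with center $a\in\mathbb{R}^d$ is the closed segment $\{a+te : t\in[-\tfrac12,\tfrac12]\}$ of length $1$. *)

(* Defs.v *)
From mathcomp Require Import all_boot all_order all_algebra.
From mathcomp Require Import all_classical all_reals all_analysis.
Import Order.TTheory GRing.Theory Num.Theory.
Import numFieldNormedType.Exports.

Set Implicit Arguments.
Unset Strict Implicit.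
Unset Printing Implicit Defensive.

Local Open Scope classical_set_scope.
Local Open Scope ring_scope.

(* R^d is 'rV[R]_d.  The norm `|x| of the library on 'rV[R]_d is the sup norm:
   it induces the usual topology, but its unit sphere is the boundary of a cube,
   hence the explicit Euclidean norm. *)
Definition euclidean_norm (R : realType) (d : nat) (x : 'rV[R]_d) : R :=
  Num.sqrt (\sum_(i < d) x ord0 i ^+ 2).

Definition unit_sphere (R : realType) (d : nat) : set 'rV[R]_d :=
  [set e | euclidean_norm e = 1].
Arguments unit_sphere R d : clear implicits.

Definition unit_segment (R : realType) (d : nat) (a e : 'rV[R]_d) :
    set 'rV[R]_d :=
  [set a + t *: e | t in `[- (1 / 2), 1 / 2]].

Definition borel_set (T : topologicalType) (A : set T) : Prop :=
  <<s (@open T) >> A.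

Definition box (R : realType) (d : nat) (u v : 'rV[R]_d) : set 'rV[R]_d :=
  [set x | forall i, u ord0 i <= x ord0 i <= v ord0 i].

Definition box_volume (R : realType) (d : nat) (u v : 'rV[R]_d) : R :=
  \prod_(i < d) (v ord0 i - u ord0 i).

(* The requirement u k <= v k (coordinatewise) makes [box_volume] the volume of
   the box; degenerate boxes are allowed, so finite covers are included. *)
Definition box_cover (R : realType) (d : nat) (A : set 'rV[R]_d)
    (u v : nat -> 'rV[R]_d) : Prop :=
  (forall k i, u k ord0 i <= v k ord0 i) /\
  A `<=` \bigcup_k box (u k) (v k).

(* Lebesgue measure on R^d is the restriction of this outer measure to the
   measurable sets; compact sets are measurable, so a compact set has Lebesgue
   measure zero exactly when its outer measure is zero. *)
Definition lebesgue_outer_measure (R : realType) (d : nat) (A : set 'rV[R]_d) :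
    \bar R :=
  ereal_inf [set s : \bar R | exists u v : nat -> 'rV[R]_d, box_cover A u v /\
    (s = \sum_(0 <= k <oo) (box_volume (u k) (v k))%:E)%E].

(* Main.v *)
Require Import Defs.
From mathcomp Require Import all_boot all_order all_algebra.
From mathcomp Require Import all_classical all_reals all_analysis.
From mathcomp Require Import ring lra zify.
Import Order.TTheory GRing.Theory Num.Theory.
Import numFieldNormedType.Exports.

(* It suffices to treat the directions e with e_i = 1 and |e_j| <= 1, and to let
   the centre depend only on one further coordinate of e, the slope; the problem
   then becomes planar.  An uncountable Borel set is the projection of a closed
   subset of R^d x N^N; at its condensation points every centre c has other
   centres c' of the same kind arbitrarily close to it, and limits of such
   centres stay in A.

   Suppose finitely many centres have been assigned to intervals of slopes.  On a
   short interval of slopes, alternate between c and a nearby c' with a period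
   proportional to |c' - c|: the segments through c' then overlap those through c
   so much that a fixed proportion of the swept region becomes free.  Shifting
   the alternation by one of K phases, every point becomes free for at least one
   phase.  If the phases of the different slope intervals are independent, a
   point covered k times becomes free with probability at least K^-k.  Since the
   total multiplicity is bounded, half of the swept area is covered a bounded
   number of times, so as long as the area is bounded below, some choice of phases
   decreases it by a definite amount.  Iterating makes the area arbitrarily small,
   and the intersection of the resulting covers is the required set. *)

Set Implicit Arguments.
Unset Strict Implicit.
Unset Printing Implicit Defensive.

Local Open Scope ring_scope.

(** * Counting grid cells *)

(** The probabilistic step, by averaging over all phase vectors [w]. A cell near at most [M] slope
    intervals is avoided by at least a fraction K^-M of them: each nearby interval leaves it at
    least one phase, every other interval leaves all [K]. *)
Lemma exists_avoiding_choice (X Q : finType) (K M : nat)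
    (bad : Q -> 'I_K -> pred X) (near : Q -> pred X) (G : {set X}) :
  (0 < K)%N ->
  (forall x q, exists j, ~~ bad q j x) ->
  (forall x q j, bad q j x -> near q x) ->
  exists w : {ffun Q -> 'I_K},
    (#|[set x in G | #|[set q | near q x]| <= M]| <=
     K ^ M * #|[set x in G | [forall q, ~~ bad q (w q) x]]|)%N.
Proof.
move=> hK hav hnear.
set low := [set x in G | (#|[set q | near q x]| <= M)%N].
pose av x : {set {ffun Q -> 'I_K}} :=
  [set w : {ffun Q -> 'I_K} | [forall q, ~~ bad q (w q) x]].
have avE x : #|av x| = (\prod_(q : Q) #|[pred j | ~~ bad q j x]|)%N.
  transitivity #|(family (fun q => [pred j | ~~ bad q j x]) :
      simpl_pred {ffun Q -> 'I_K})|; last by rewrite card_family foldrE big_map big_enum.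
  apply: eq_card => w; rewrite inE.
  by apply/forallP/familyP => h q; have := h q.
have avlow x : x \in low -> (K ^ #|Q| <= K ^ M * #|av x|)%N.
  rewrite inE => /andP[_ hM].
  have -> : (K ^ #|Q| = \prod_(q : Q) K)%N by rewrite prod_nat_const.
  rewrite avE (bigID (fun q => near q x)) /= leq_mul //.
    rewrite prod_nat_const; apply: leq_pexp2l => //.
    by apply: leq_trans hM; apply/eq_leq/eq_card => y; rewrite inE.
  rewrite [leqRHS](bigID (fun q => near q x)) /= -[leqLHS]mul1n leq_mul //.
    apply: prodn_cond_gt0 => q _; apply/card_gt0P.
    by case: (hav x q) => j hj; exists j; rewrite inE.
  apply: leq_prod => q hq; apply/eq_leq; rewrite -[LHS]card_ord.
  apply: eq_card => j; rewrite !inE; apply/esym.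
  by apply: contra hq; apply: hnear.
have cf : #|{ffun Q -> 'I_K}| = (K ^ #|Q|)%N by rewrite card_ffun card_ord.
(* Double counting of the pairs of a phase vector and a cell of [G] that it avoids. *)
have dbl : (\sum_(w : {ffun Q -> 'I_K})
      #|[set x in G | [forall q, ~~ bad q (w q) x]]| = \sum_(x in G) #|av x|)%N.
  transitivity (\sum_(w : {ffun Q -> 'I_K}) \sum_(x in G | w \in av x) 1)%N.
    apply: eq_bigr => w _; rewrite -sum1_card; apply: eq_bigl => x.
    by rewrite !inE.
  rewrite (exchange_big_dep (mem G)) /=; last by move=> w x _ /andP[].
  apply: eq_bigr => x xG; rewrite -sum1_card; apply: eq_bigl => w.
  by rewrite xG.
have slow : (#|low| * K ^ #|Q| <= K ^ M * \sum_(x in G) #|av x|)%N.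
  apply: (@leq_trans (\sum_(x in low) K ^ M * #|av x|)%N).
    by rewrite -sum_nat_const; apply: leq_sum => x; apply: avlow.
  rewrite -big_distrr leq_mul2l; apply/orP; right.
  rewrite [leqRHS](bigID (fun x => x \in low)) /=.
  apply: (@leq_trans (\sum_(i in G | i \in low) #|av i|)%N); last exact: leq_addr.
  apply/eq_leq/eq_bigl => x; rewrite inE.
  by case: (x \in G).
apply: contrapT => hno.
have hlt (w : {ffun Q -> 'I_K}) :
    (K ^ M * #|[set x in G | [forall q, ~~ bad q (w q) x]]| < #|low|)%N.
  by rewrite ltnNge; apply/negP => h; apply: hno; exists w.
have : (K ^ M * \sum_(x in G) #|av x| < #|low| * K ^ #|Q|)%N.
  rewrite -dbl big_distrr /= mulnC -cf -sum_nat_const.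
  have w0 : [ffun=> Ordinal hK] \in {: {ffun Q -> 'I_K}} by [].
  rewrite (bigD1 _ w0) [ltnRHS](bigD1 _ w0) /= -addSn.
  by apply: leq_add => //; apply: leq_sum => w _; apply: ltnW.
by rewrite ltnNge slow.
Qed.

Section Grid.
Variable R : realType.

Definition idx (n : nat) (u : R) : nat := Num.truncn (n%:R * u).

Lemma idx_itv n u : 0 <= u -> (idx n u)%:R <= n%:R * u < (idx n u).+1%:R.
Proof. by move=> u0; apply: truncn_itv; rewrite mulr_ge0. Qed.

Lemma idx_lt n m u : 0 <= u -> u < m%:R -> (0 < n)%N -> (idx n u < m * n)%N.
Proof.
move=> u0 um n0; rewrite truncn_lt_nat ?mulr_ge0// natrM mulrC ltr_pM2r//.
by rewrite ltr0n.
Qed.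

(** Grids of steps 1/n and 1/(nk) are nested; the cells of the plane and the slope intervals are
    both refined in this way. *)
Lemma idx_div n k u : 0 <= u -> (0 < k)%N -> (idx (n * k) u %/ k)%N = idx n u.
Proof.
move=> u0 k0; apply/esym/truncn_def.
have /andP[h1 h2] := idx_itv (n * k) u0.
set a := idx _ _ in h1 h2 *.
have k0' : 0 < k%:R :> R by rewrite ltr0n.
apply/andP; split.
  rewrite -(ler_pM2r k0') -natrM (le_trans _ (_ : a%:R <= _))//.
    by rewrite ler_nat leq_trunc_div.
  by rewrite (le_trans h1)// natrM mulrAC.
rewrite -(ltr_pM2r k0') mulrAC -natrM; apply: lt_le_trans h2 _.
by rewrite -natrM ler_nat ltn_ceil.
Qed.

Lemma idx_diff n u v : (idx n u)%:R - (idx n v)%:R <= n%:R * `|u - v| + 1 :> R.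
Proof.
have hv : n%:R * v < (idx n v)%:R + 1 by rewrite natr1 truncnS_gt.
have uv : n%:R * u <= n%:R * v + n%:R * `|u - v|.
  by rewrite -mulrDr ler_wpM2l// -lerBlDl ler_norm.
have [u0|u0] := leP 0 u; first by have /andP[h1 h2] := idx_itv n u0; lra.
(* [truncn] sends negative numbers to 0. *)
have -> : idx n u = 0%N.
  apply/eqP; rewrite -leqn0 truncn_le_nat (le_lt_trans _ ltr01)//.
  by rewrite mulr_ge0_le0// ltW.
have : 0 <= n%:R * `|u - v| by rewrite mulr_ge0.
have : 0 <= (idx n v)%:R :> R by [].
lra.
Qed.

Lemma idx_eq_close n u v : (0 < n)%N -> 0 <= u -> 0 <= v ->
  idx n u = idx n v -> `|u - v| <= n%:R^-1.
Proof.
move=> n0 u0 v0 e; have n0' : 0 < n%:R :> R by rewrite ltr0n.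
have /andP[a1 a2] := idx_itv n u0; have /andP[b1 b2] := idx_itv n v0.
rewrite e -!natr1 in a1 a2 b1 b2.
rewrite -(ler_pM2l n0') mulfV ?gt_eqF// -[X in X * _]ger0_norm// -normrM mulrBr.
by rewrite ler_norml; apply/andP; split; lra.
Qed.

Lemma card_le_diff n (S : {set 'I_n}) (D : R) : 0 <= D ->
  {in S &, forall i j : 'I_n, i%:R - j%:R <= D} -> #|S|%:R <= D + 1.
Proof.
move=> D0 hS; have [->|[i0 i0S]] := set_0Vmem S.
  by rewrite cards0 (le_trans D0)// lerDl.
case: (arg_minnP (fun i : 'I_n => nat_of_ord i) i0S) => m mS mmin.
have hb i : i \in S -> (i - m < (Num.truncn D).+1)%N.
  move=> iS; rewrite ltnS truncn_ge_nat// natrB ?mmin//; exact: hS.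
pose f (i : 'I_n) : 'I_(Num.truncn D).+1 := inord (i - m).
have /leq_card_in : {in S &, injective f}.
  move=> i j iS jS /(congr1 val); rewrite /= !inordK ?hb// => e.
  by apply: val_inj => /=; have := mmin _ iS; have := mmin _ jS; lia.
rewrite card_ord => hc.
have /andP[h _] := truncn_itv D0.
by rewrite (@le_trans _ _ (Num.truncn D).+1%:R)// ?ler_nat// -natr1 lerD2r.
Qed.

(** The area of a set in the square [0, 4)^2 is replaced throughout by the number of cells of side
    1/n that it meets, divided by n^2. *)
Definition hit (n : nat) (S : set (R * R)) : {set 'I_(4 * n) * 'I_(4 * n)} :=
  [set ij : 'I_(4 * n) * 'I_(4 * n) |
    `[< exists p, [/\ S p, idx n p.1 = ij.1 & idx n p.2 = ij.2] >]].

Lemma hitP n S (ij : 'I_(4 * n) * 'I_(4 * n)) : reflect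
  (exists p, [/\ S p, idx n p.1 = ij.1 & idx n p.2 = ij.2]) (ij \in hit n S).
Proof. by rewrite inE; apply: asboolP. Qed.

Arguments hitP {n S ij}.

(** Count by columns: width [X] allows at most nX + 2 columns. Inside one column abscissae differ by
    at most 1/n, so heights spread over at most Y + 1/n, which allows nY + 3 cells. *)
Lemma card_hit n (S : set (R * R)) (X Y : R) : (0 < n)%N -> 0 <= X -> 0 <= Y ->
  (forall p, S p -> 0 <= p.1) ->
  (forall p q, S p -> S q -> `|p.1 - q.1| <= X) ->
  (forall p q, S p -> S q -> `|p.2 - q.2| <= Y + `|p.1 - q.1|) ->
  #|hit n S|%:R <= (n%:R * X + 2) * (n%:R * Y + 3).
Proof.
move=> n0 X0 Y0 S0 hX hY.
have n0' : 0 < n%:R :> R by rewrite ltr0n.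
set H := hit n S; pose I := fst @: H.
have hI : #|I|%:R <= n%:R * X + 1 + 1.
  apply: card_le_diff; first by rewrite addr_ge0// mulr_ge0.
  move=> _ _ /imsetP[p pH ->] /imsetP[q qH ->].
  have [p' [Sp <- _]] := hitP pH; have [q' [Sq <- _]] := hitP qH.
  rewrite (le_trans (idx_diff _ _ _))// lerD2r ler_wpM2l//; exact: hX.
have -> : #|H| = (\sum_(i in I) #|[set p in H | p.1 == i]|)%N.
  rewrite -sum1_card (partition_big fst (mem I))/=; last first.
    by move=> p pH; apply: imset_f.
  apply: eq_bigr => i _; rewrite -sum1_card; apply: eq_bigl => p.
  by rewrite !inE.
rewrite natr_sum.
apply: (@le_trans _ _ (\sum_(i in I) (n%:R * Y + 3))); last first.
  rewrite sumr_const -[leLHS]mulr_natl ler_wpM2r//; last by lra.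
  by rewrite addr_ge0// mulr_ge0.
apply: ler_sum => i _.
set F := [set p in H | p.1 == i].
have -> : #|F| = #|snd @: F|.
  rewrite card_in_imset// => -[a b] [a' b']; rewrite !inE /=.
  by move=> /andP[_ /eqP->] /andP[_ /eqP->] ->.
apply: le_trans (_ : n%:R * Y + 2 + 1 <= _); last by lra.
apply: card_le_diff; first by rewrite addr_ge0// mulr_ge0.
move=> _ _ /imsetP[p + ->] /imsetP[q + ->].
rewrite finset.in_set => /andP[/hitP[p' [Sp p1 <-]] /eqP pi].
rewrite finset.in_set => /andP[/hitP[q' [Sq q1 <-]] /eqP qi].
rewrite (le_trans (idx_diff _ _ _))//.
have hx : n%:R * `|p'.1 - q'.1| <= 1.
  rewrite mulrC -ler_pdivlMr// div1r idx_eq_close ?S0//.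
  by rewrite p1 q1 pi qi.
have : n%:R * `|p'.2 - q'.2| <= n%:R * (Y + `|p'.1 - q'.1|).
  by rewrite ler_wpM2l// hY.
by rewrite mulrDr; lra.
Qed.

End Grid.

(** * Interleaving two pencils of lines *)

Section Comb.
Variable R : realType.

(** The forbidden set is a neighbourhood of [0, 1 - rho/2] modulo 1. The phases j/K are dense enough
    for one of them to bring [X] close to 1 - rho/4, the middle of the remaining gap. *)
Lemma phase_gap (K : nat) (rho e X : R) : (0 < K)%N -> 0 < rho ->
  e <= rho / 16 -> K%:R^-1 <= rho / 16 ->
  exists j : 'I_K, forall z : int,
    ~ (- e <= X - j%:R / K%:R - z%:~R <= 1 - rho / 2 + e).
Proof.
move=> K0 rho0 he hK.
have K0' : 0 < K%:R :> R by rewrite ltr0n.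
pose f := Num.floor (X - (1 - rho / 4)); pose r := X - (1 - rho / 4) - f%:~R.
have /andP[f1 f2] := floor_itv (X - (1 - rho / 4)).
have r0 : 0 <= r by rewrite /r subr_ge0.
have r1 : r < 1%:R by rewrite intrD in f2; rewrite /r; lra.
have jK : (idx K r < K)%N by rewrite -[ltnRHS]mul1n idx_lt.
exists (Ordinal jK) => z /= /andP[z1 z2].
have /andP[u1 u2] := idx_itv K r0.
have hu1 : (idx K r)%:R / K%:R <= r by rewrite ler_pdivrMr// mulrC.
have hu2 : r < (idx K r)%:R / K%:R + K%:R^-1.
  by rewrite -[X in _ + X]mul1r -mulrDl ltr_pdivlMr// mulrC natr1.
set u := _ / K%:R in z1 z2 hu1 hu2.
have hz : (f - z)%:~R < 0 :> R by rewrite rmorphB /=; rewrite /r in hu1; lra.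
rewrite ltrz0 in hz.
have : (f - z + 1)%:~R <= 0 :> R by rewrite lerz0 lezD1.
rewrite rmorphD rmorphB /=; rewrite /r in hu2; lra.
Qed.

Lemma ler_norm_div (x y T rho : R) : 0 < rho -> rho <= T -> `|x| <= y ->
  `|x / T| <= y / rho.
Proof.
move=> rho0 hT xy; have T0 : 0 < T by lra.
rewrite normrM normfV (gtr0_norm T0) ler_pM// ?invr_ge0 ?(ltW T0)//.
by rewrite lef_pV2 ?posrE.
Qed.

Lemma norm_div_double (x h c : R) : 0 < h -> `|x| <= c * h / 16 ->
  `|x / (2 * h)| <= c / 32.
Proof.
move=> h0 hx; have h2 : 0 < 2 * h by rewrite mulr_gt0.
by rewrite normrM normfV (gtr0_norm h2) ler_pdivrMr//; lra.
Qed.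

(* The lines through c0 = (a0, b0) and c1 = c0 + (v1, v2) are interleaved: a
   slope within w' of mf is served by c0 or c1 according to the half of the
   period 2h that contains mf. *)
Definition comb_pts (rho a0 b0 v1 v2 mq h w1 w' dl y0 : R) : set (R * R) :=
  [set p | exists m mf t d1 d2,
    [/\ mq <= m <= mq + w1, mf <= m <= mf + w', `|m| <= 1, 2 * rho <= t <= 1 / 2 &
     [/\ `|d1| <= dl, `|d2| <= dl &
      let phi := (mf - mq) / (2 * h) - y0 in
      let c := phi - (Num.floor phi)%:~R < 1 / 2 in
      p = (a0 + (if c then 0 else v1) + d1 + t,
           b0 + (if c then 0 else v2) + d2 + t * m)]]]%classic.

(** Measure the slope under which a point is seen from c0 as a phase modulo the period [2 * h].
    Points served by c0 have phase in [0, 1/2]. For points served by c1 the phase in [1/2, 1] is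
    lowered by (rho/T)/2, where T = p.1 - a0, because c1 lies [rho * h] below the line of slope [mq]
    through c0. As rho <= T <= 1, they land in [0, 1 - rho/2], and the end of the period stays free
    up to an error rho/32. *)
Lemma comb_slope rho a0 b0 v1 v2 mq h w1 w' dl y0 p :
  0 < rho <= 1 / 8 -> 0 < h <= 1 -> v2 - v1 * mq = - (rho * h) ->
  `|v1| + dl <= rho -> `|v1| * w1 <= rho ^+ 2 * h / 32 ->
  w' <= rho * h / 64 -> 2 * dl / rho <= rho * h / 64 ->
  comb_pts rho a0 b0 v1 v2 mq h w1 w' dl y0 p ->
  [/\ rho <= p.1 - a0, p.1 - a0 <= 1, `|(p.2 - b0) / (p.1 - a0)| <= 3 &
    exists z : int, - (rho / 32) <=
      ((p.2 - b0) / (p.1 - a0) - mq) / (2 * h) - y0 - z%:~R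
      <= 1 - rho / 2 + rho / 32].
Proof.
move=> /andP[rho0 rho1] /andP[h0 h1] hs hv hw1 hw' hdl.
move=> [m [mf [t [d1 [d2 [hm hmf m1 ht [hd1 hd2]]]]]]].
set phi := (mf - mq) / (2 * h) - y0.
move=> /=; set c := (_ < _) => ->.
have {hm} /andP[hm hm'] := hm; have {hmf} /andP[hmf hmf'] := hmf.
have {ht} /andP[ht ht'] := ht.
have /andP[f1 f2] := floor_itv phi.
set z := Num.floor phi in f1 f2 c *.
rewrite intrD in f2.
have dm : `|d2 - d1 * m| <= 2 * dl.
  rewrite (le_trans (ler_normB _ _))// normrM.
  have : `|d1| * `|m| <= dl * 1 by rewrite ler_pM.
  lra.
have dl0 : 0 <= dl by apply: le_trans hd1.
have v1b : `|v1| <= rho by lra.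
have [c1|c1] := boolP c => /=.
  set T := a0 + 0 + d1 + t - a0.
  have TE : T = d1 + t by rewrite /T; ring.
  have /ler_normlP[e1 e2] := hd1.
  have T1 : rho <= T by rewrite TE; have := normr_ge0 v1; lra.
  have T2 : T <= 1 by rewrite TE; have := normr_ge0 v1; lra.
  have muE : (b0 + 0 + d2 + t * m - b0) / T = m + (d2 - d1 * m) / T.
    by rewrite TE; field; rewrite -TE gt_eqF//; lra.
  rewrite muE.
  have := ler_norm_div rho0 T1 dm; set X := _ / T => hX.
  have /ler_normlP[X1 X2] := hX.
  have xh : rho * h <= 1 / 8 by rewrite -[leRHS]mulr1 ler_pM// ltW.
  split => //.
    rewrite (le_trans (ler_normD _ _))//.
    lra.
  exists z.
  have -> : (m + X - mq) / (2 * h) - y0 - z%:~R =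
      (phi - z%:~R) + (m - mf + X) / (2 * h).
    by rewrite /phi; field; rewrite gt_eqF.
  have : `|(m - mf + X) / (2 * h)| <= rho / 32.
    apply: norm_div_double => //.
    rewrite (le_trans (ler_normD _ _))// ger0_norm; lra.
  rewrite ler_norml => /andP[y1 y2].
  rewrite /c in c1; apply/andP; split; lra.
set T := a0 + v1 + d1 + t - a0.
have TE : T = v1 + d1 + t by rewrite /T; ring.
have /ler_normlP[e1 e2] := hd1; have /ler_normlP[e3 e4] : `|v1| <= `|v1| by [].
have T1 : rho <= T by rewrite TE; lra.
have T2 : T <= 1 by rewrite TE; lra.
have hE : `|- v1 * (m - mq) + (d2 - d1 * m)| <= rho ^+ 2 * h / 32 + 2 * dl.
  rewrite (le_trans (ler_normD _ _))// lerD// normrM normrN.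
  apply: le_trans hw1; rewrite ler_wpM2l// ger0_norm; lra.
have T0 : T != 0 by rewrite gt_eqF//; lra.
(* [W / 2] is the part of a period by which the slope drops when seen from c0 instead of c1. *)
pose W := rho / T.
have W1 : rho <= W by rewrite ler_pdivlMr ?ger_pMr//; lra.
have W2 : W <= 1 by rewrite ler_pdivrMr ?mul1r//; lra.
have muE : (b0 + v2 + d2 + t * m - b0) / T =
    m + (- v1 * (m - mq) + (d2 - d1 * m)) / T - W * h.
  have -> : v2 = v1 * mq - rho * h by rewrite -[LHS](subrK (v1 * mq)) hs addrC.
  by rewrite /W TE; field; rewrite -TE.
rewrite muE.
have := ler_norm_div rho0 T1 hE; set X := _ / T => hX.
have {}hX : `|X| <= rho * h / 32 + 2 * dl / rho.
  by move: hX; rewrite mulrDl (_ : rho ^+ 2 * h / 32 / rho = rho * h / 32)//;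
    field; rewrite gt_eqF.
have hX' : `|X| <= rho * h * 3 / 64 by lra.
clear muE hE hX hs hdl hw1 TE dm e1 e2 e3 e4 ht ht' hv hd1 hd2.
clearbody X T W.
have W0 : 0 <= W by lra.
have Wh : 0 <= W * h <= 1 by rewrite mulr_ge0 ?mulr_ile1// ltW.
split => //.
  have xh : rho * h <= 1 / 8 by rewrite -[leRHS]mulr1 ler_pM// ltW.
  rewrite (le_trans (ler_normB _ _))// (le_trans (lerD (ler_normD _ _) (lexx _)))//.
  case/andP: Wh => ? ?; rewrite [`|W * h|]ger0_norm//; lra.
exists z.
have -> : (m + X - W * h - mq) / (2 * h) - y0 - z%:~R =
    (phi - z%:~R) + (m - mf + X) / (2 * h) - W / 2.
  by rewrite /phi; field; rewrite gt_eqF.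
have : `|(m - mf + X) / (2 * h)| <= rho / 32.
  apply: norm_div_double => //.
  rewrite (le_trans (ler_normD _ _))// ger0_norm; lra.
rewrite ler_norml => /andP[y1 y2].
clear hX' Wh hw'; rewrite /c -leNgt in c1; apply/andP; split; lra.
Qed.
End Comb.

(** Markov's inequality for the number of slope intervals near a cell. *)
Lemma card_high (X Q : finType) (M : nat) (near : Q -> pred X) :
  (M.+1 * #|[set x | (M < #|[set q | near q x]|)%N]| <=
   \sum_q #|[set x | near q x]|)%N.
Proof.
have -> : (\sum_q #|[set x | near q x]| = \sum_x #|[set q | near q x]|)%N.
  transitivity (\sum_q \sum_(x | near q x) 1)%N.
    by apply: eq_bigr => q _; rewrite -sum1_card; apply: eq_bigl => x; rewrite inE.
  rewrite (exchange_big_dep (fun _ => true)) //=.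
  by apply: eq_bigr => x _; rewrite -sum1_card; apply: eq_bigl => q; rewrite inE.
set H := [set x | _]; rewrite [leqRHS](bigID (mem H)) /= mulnC -sum_nat_const.
by apply: leq_trans (leq_addr _ _); apply: leq_sum => x; rewrite inE.
Qed.

(** * Thickened fans of segments and the cells that they meet *)

Section Fan.
Variable R : realType.

Definition fan_pts (a b m0 w tm dl : R) : set (R * R) :=
  [set p | exists m t d1 d2,
    [/\ m0 <= m <= m0 + w, `|m| <= 1, `|t| <= tm &
     [/\ `|d1| <= dl, `|d2| <= dl & p = (a + d1 + t, b + d2 + t * m)]]]%classic.

(** At a fixed abscissa, changing the slope by at most [w] moves a point by at most [tm * w], and
    the perturbations add at most [4 * dl] because |m| <= 1. With n >= 4 the rounding is absorbed in
    the factor 2n. *)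
Lemma card_fan n (a b m0 w tm dl : R) : (4 <= n)%N -> 1 <= a ->
  0 <= w -> 0 <= tm <= 1 / 2 -> 0 <= dl <= 1 / 4 ->
  #|hit n (fan_pts a b m0 w tm dl)|%:R <=
    2 * n%:R * (n%:R * (tm * w + 4 * dl) + 3).
Proof.
move=> n4 a1 w0 /andP[tm0 tm1] /andP[dl0 dl1].
have n4' : 4 <= n%:R :> R by rewrite (ler_nat R 4).
have tw : 0 <= tm * w by rewrite mulr_ge0.
apply: (@le_trans _ _ ((n%:R * (1 + 2 * dl) + 2) *
    (n%:R * (tm * w + 4 * dl) + 3))); last first.
  have nd : n%:R * dl <= n%:R * (1 / 4) by rewrite ler_wpM2l.
  apply: ler_wpM2r; last by lra.
  by rewrite addr_ge0// mulr_ge0//; lra.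
apply: card_hit; [by apply: leq_trans n4|lra|lra| | |].
- move=> _ [m [t [d1 [d2 [_ _ ht [hd1 _ ->]]]]]] /=.
  by move: ht hd1; rewrite !ler_norml => /andP[? ?] /andP[? ?]; lra.
- move=> _ _ [m [t [d1 [d2 [_ _ ht [hd1 _ ->]]]]]]
  [m' [t' [d1' [d2' [_ _ ht' [hd1' _ ->]]]]]] /=.
  move: ht hd1 ht' hd1'; rewrite !ler_norml.
  by move=> /andP[? ?] /andP[? ?] /andP[? ?] /andP[? ?]; apply/andP; split; lra.
move=> _ _ [m [t [d1 [d2 [hm _ ht [hd1 hd2 ->]]]]]]
  [m' [t' [d1' [d2' [hm' m1' ht' [hd1' hd2' ->]]]]]] /=.
set x := a + d1 + t - _.
have -> : b + d2 + t * m - (b + d2' + t' * m') =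
  (d2 - d2') + t * (m - m') + m' * (x - (d1 - d1')) by rewrite /x; ring.
have h1 : `|d2 - d2'| <= 2 * dl.
  by rewrite (le_trans (ler_normB _ _))//; lra.
have h2 : `|d1 - d1'| <= 2 * dl.
  by rewrite (le_trans (ler_normB _ _))//; lra.
have h3 : `|t * (m - m')| <= tm * w.
  rewrite normrM ler_pM// ler_norml; move: hm hm' => /andP[? ?] /andP[? ?].
  by apply/andP; split; lra.
have h4 : `|m' * (x - (d1 - d1'))| <= 1 * (`|x| + 2 * dl).
  by rewrite normrM ler_pM// (le_trans (ler_normB _ _))// lerD2l.
rewrite (le_trans (ler_normD _ _))// (le_trans (lerD (ler_normD _ _) (lexx _)))//.
lra.
Qed.

(** The fan does not depend on the phase [y0], so it can serve as the relation [near] of the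
    averaging argument. *)
Lemma comb_sub_fan rho a0 b0 v1 v2 mq h w1 w' dl y0 a b r :
  `|a0 - a| <= r -> `|a0 + v1 - a| <= r -> `|b0 - b| <= r ->
  `|b0 + v2 - b| <= r -> 0 < rho -> dl <= r ->
  (comb_pts rho a0 b0 v1 v2 mq h w1 w' dl y0 `<=`
   fan_pts a b mq w1 (1 / 2) (2 * r))%classic.
Proof.
move=> ha0 ha1 hb0 hb1 rho0 dlr.
move=> p [m [mf [t [d1 [d2 [hm _ m1 ht [hd1 hd2]]]]]]] /=.
set c := (_ < _) => ->.
have t2 : `|t| <= 1 / 2 by case/andP: ht => ? ?; rewrite ger0_norm; lra.
exists m, t, (a0 + (if c then 0 else v1) - a + d1),
  (b0 + (if c then 0 else v2) - b + d2); split => //; split.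
- by rewrite (le_trans (ler_normD _ _))//; case: (c); rewrite ?addr0; lra.
- by rewrite (le_trans (ler_normD _ _))//; case: (c); rewrite ?addr0; lra.
- by case: (c); congr pair; ring.
Qed.

(** All comb points of one cell are seen from c0 under phases within rho/32 of each other, so the
    gap found for one reference point serves the whole cell. The tolerance rho/16 is rho/32 from the
    comb plus rho/32 from the cell. *)
Lemma comb_avoid (K n : nat) (rho a0 b0 v1 v2 mq h w1 w' dl : R)
    (ij : 'I_(4 * n) * 'I_(4 * n)) :
  (0 < n)%N -> 0 < rho <= 1 / 8 -> 0 < h <= 1 -> v2 - v1 * mq = - (rho * h) ->
  `|v1| + dl <= rho -> `|v2| + dl <= rho -> `|v1| * w1 <= rho ^+ 2 * h / 32 ->
  w' <= rho * h / 64 -> 2 * dl / rho <= rho * h / 64 ->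
  1 <= a0 -> 1 <= b0 ->
  (0 < K)%N -> K%:R^-1 <= rho / 16 -> 4 * n%:R^-1 / rho <= rho * h / 16 ->
  exists j : 'I_K, ij \notin hit n
    (comb_pts rho a0 b0 v1 v2 mq h w1 w' dl (j%:R / K%:R)).
Proof.
move=> n0 hrho hh hs hv1 hv2 hw1 hw' hdl ha hb K0 hK hn.
(* [idx] sends every negative number to 0, so points of equal index are known to be close only for
   nonnegative coordinates. *)
have pos y0 p : comb_pts rho a0 b0 v1 v2 mq h w1 w' dl y0 p -> 0 <= p.2.
  move=> [m [mf [t [d1 [d2 [_ _ m1 ht [_ hd2]]]]]]] /=.
  set c := (_ < _) => -> /=.
  have tm : `|t * m| <= 1 / 2 * 1.
    by rewrite normrM ler_pM//; case/andP: ht => ? ?; rewrite ger0_norm; lra.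
  have {tm} /ler_normlP[? ?] := tm; have /ler_normlP[? ?] := hd2.
  have /ler_normlP[? ?] := lexx `|v2|; have := normr_ge0 v2.
  by case: c; lra.
have slope y0 p := @comb_slope R rho a0 b0 v1 v2 mq h w1 w' dl y0 p hrho hh hs
  hv1 hw1 hw' hdl.
case: (pselect (exists y0 p, [/\ comb_pts rho a0 b0 v1 v2 mq h w1 w' dl y0 p,
    idx n p.1 = ij.1 & idx n p.2 = ij.2])); last first.
  move=> hno; exists (Ordinal K0); apply/negP => /hitP[p hp].
  by apply: hno; exists ((Ordinal K0)%:R / K%:R), p.
move=> [y0 [p0 [hp0 p01 p02]]].
have [T1 T2 mu0 _] := slope _ _ hp0.
have /andP[rho0 _] := hrho; have /andP[h0 _] := hh.
have [j hj] := @phase_gap R K rho (rho / 16)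
  (((p0.2 - b0) / (p0.1 - a0) - mq) / (2 * h)) K0 rho0 (lexx _) hK.
exists j; apply/negP => /hitP[p [hp p1 p2]].
have [T3 T4 mu [z hz]] := slope _ _ hp.
apply: (hj z).
have x01 : `|p.1 - p0.1| <= n%:R^-1.
  by apply: idx_eq_close => //; [lra|lra|rewrite p1 p01].
have y01 : `|p.2 - p0.2| <= n%:R^-1.
  apply: idx_eq_close => //; last by rewrite p2 p02.
  - exact: pos hp.
  - exact: pos hp0.
pose m0 := (p0.2 - b0) / (p0.1 - a0).
have e : (p.2 - b0) / (p.1 - a0) - m0 =
    ((p.2 - p0.2) - m0 * (p.1 - p0.1)) / (p.1 - a0).
  rewrite /m0; field; apply/andP; split; rewrite gt_eqF//; lra.
have : `|((p.2 - b0) / (p.1 - a0) - m0) / (2 * h)| <= rho / 32.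
  apply: norm_div_double => //; rewrite e.
  apply: le_trans hn; apply: ler_norm_div => //.
  rewrite (le_trans (ler_normB _ _))// normrM.
  have : `|m0| * `|p.1 - p0.1| <= 3 * n%:R^-1 by rewrite ler_pM.
  lra.
rewrite -/m0; move: hz; rewrite !mulrBl; set A := _ / (p.1 - a0) / _.
set B := m0 / _; set C := mq / _.
rewrite ler_norml => /andP[? ?] /andP[? ?].
by apply/andP; split; lra.
Qed.
End Fan.

(** * Reducing the swept area *)

Section Reduce.
Variable R : realType.

Lemma exists_pos_le4 (a b c d : R) : 0 < a -> 0 < b -> 0 < c -> 0 < d ->
  exists e, [/\ 0 < e, e <= a, e <= b, e <= c & e <= d].
Proof.
move=> a0 b0 c0 d0; exists (Num.min (Num.min a b) (Num.min c d)).
by rewrite !lt_min a0 b0 c0 d0 !ge_min !lexx ?orbT; split.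
Qed.

Lemma exists_nat_ge4 (a b c d : R) : exists n : nat,
  [/\ (0 < n)%N, a <= n%:R, b <= n%:R, c <= n%:R & d <= n%:R].
Proof.
exists (Num.truncn (`|a| + `|b| + `|c| + `|d|)).+1.
have /ltW := truncnS_gt (`|a| + `|b| + `|c| + `|d|).
have := ler_norm a; have := ler_norm b; have := ler_norm c; have := ler_norm d.
have := normr_ge0 a; have := normr_ge0 b; have := normr_ge0 c.
by have := normr_ge0 d; split => //; lra.
Qed.

Lemma exists_min_pos (F : nat -> R) (n : nat) : (forall q, 0 < F q) ->
  exists e, 0 < e /\ forall q, (q < n)%N -> e <= F q.
Proof.
move=> F0; elim: n => [|n [e [e0 he]]]; first by exists 1.
exists (Num.min e (F n)); rewrite lt_min e0 F0; split => // q.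
rewrite ltnS leq_eqVlt => /orP[/eqP->|/he]; rewrite ge_min ?lexx ?orbT//.
by move=> ->.
Qed.

Lemma slope_itv n (u : R) : (0 < n)%N -> 0 <= u ->
  (idx n u)%:R / n%:R - 1 / 2 <= u - 1 / 2 <=
    (idx n u)%:R / n%:R - 1 / 2 + n%:R^-1.
Proof.
move=> n0 u0; have /andP[h1 h2] := idx_itv n u0.
have n0' : 0 < n%:R :> R by rewrite ltr0n.
have : (idx n u)%:R / n%:R <= u by rewrite ler_pdivrMr// mulrC.
have : u <= (idx n u)%:R / n%:R + n%:R^-1.
  by rewrite -[X in _ + X]mul1r -mulrDl ler_pdivlMr// mulrC natr1 ltW.
by move=> *; apply/andP; split; lra.
Qed.

Variable T : Type.

(* [B r z z'] reads "z' is within r of z"; [pa] and [pb] are the two planar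
   coordinates of the centre attached to a point of [T]. *)
Record perfect_system (Z : set T) (B : R -> T -> T -> Prop) (pa pb : T -> R) :
    Prop := PerfectSystem {
  ps_refl : forall r z, 0 <= r -> B r z z;
  ps_trans : forall r s x y z, B r x y -> B s y z -> B (r + s) x z;
  ps_mono : forall r s x y, r <= s -> B r x y -> B s x y;
  ps_pa : forall r x y, B r x y -> `|pa y - pa x| <= r;
  ps_pb : forall r x y, B r x y -> `|pb y - pb x| <= r;
  ps_itv : forall z, Z z -> 1 <= pa z <= 3 /\ 1 <= pb z <= 3;
  ps_perf : forall r z, 0 < r -> Z z -> exists z',
    [/\ Z z', B r z z' & (pa z', pb z') <> (pa z, pb z)] }.

(** The parameter [u] stands for the slope u - 1/2, and the centre is constant on each of the [N]
    intervals of [u]. The thickness [dl] leaves room for later displacements of the centres. *)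
Definition swept (pa pb : T -> R) (I : set R) (N : nat) (z : nat -> T) (dl : R)
    : set (R * R) :=
  [set p | exists u t d1 d2,
    [/\ 0 <= u < 1, I t, `|d1| <= dl, `|d2| <= dl &
     p = (pa (z (idx N u)) + d1 + t,
          pb (z (idx N u)) + d2 + t * (u - 1 / 2))]]%classic.

(** Away from the centre the shift between two pencils is under control. The left halves follow by
    reflection, and the middle parts have small area. *)
Definition right_times (rho : R) : set R := [set t | 2 * rho <= t <= 1 / 2]%classic.

(** Cutting every cell into p^2 cells keeps the area, so the old sweep can be compared with the new
    one on a finer grid. *)
Lemma subgrid n p (G : {set 'I_(4 * n) * 'I_(4 * n)}) : (0 < p)%N ->
  exists G' : {set 'I_(4 * (n * p)) * 'I_(4 * (n * p))},
    #|G'| = (p ^ 2 * #|G|)%N /\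
    forall (ij : 'I_(4 * (n * p)) * 'I_(4 * (n * p))) kl,
      kl \in G -> (ij.1 %/ p)%N = kl.1 -> (ij.2 %/ p)%N = kl.2 ->
      ij \in G'.
Proof.
move=> p0.
have hlt (i : 'I_(4 * n)) (r : 'I_p) : (i * p + r < 4 * (n * p))%N.
  rewrite mulnA; apply: (@leq_trans (i.+1 * p)).
    by rewrite [leqRHS]mulSn [leqRHS]addnC ltn_add2l.
  by rewrite leq_mul2r (ltn_ord i) orbT.
pose f (x : ('I_(4 * n) * 'I_(4 * n)) * ('I_p * 'I_p)) :=
  (Ordinal (hlt x.1.1 x.2.1), Ordinal (hlt x.1.2 x.2.2)).
have finj : injective f.
  move=> [[i j] [r s]] [[i' j'] [r' s']] [/= e1 e2].
  have d (a : nat) (b : 'I_p) : ((a * p + b) %/ p)%N = a.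
    by rewrite divnMDl// divn_small// addn0.
  have ei : i = i' by apply: val_inj; rewrite /= -(d i r) e1 d.
  have ej : j = j' by apply: val_inj; rewrite /= -(d j s) e2 d.
  subst i' j'; move/addnI: e1 => e1; move/addnI: e2 => e2.
  by congr (_, (_, _)); apply: val_inj.
exists (f @: finset.setX G finset.setT); split.
  by rewrite card_imset// cardsX cardsT card_prod card_ord mulnC.
move=> [i j] [k l] /= klG ik jl; apply/imsetP.
exists ((k, l), (Ordinal (ltn_pmod i p0), Ordinal (ltn_pmod j p0))).
  by rewrite !inE klG.
by congr pair; apply: val_inj => /=; rewrite -?ik -?jl -divn_eq.
Qed.

(** Bookkeeping for one step: out of [G] cells at least [2 * g * n] are freed, and at most [g * n]
    come back through the slopes without alternation. *)
Lemma gain_count (P D0 g G av bad H n : R) : 0 < P -> g = D0 / (4 * P) ->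
  (D0 * n / 2 <= P * av) -> H <= G - av + bad -> bad <= g * n ->
  H <= G - g * n.
Proof.
move=> P0 ge h1 h2 h3.
have : 2 * g * n <= av.
  rewrite -(ler_pM2l P0); apply: le_trans h1.
  by rewrite ge le_eqVlt; apply/orP; left; apply/eqP; field; rewrite gt_eqF.
lra.
Qed.

Lemma half_le (x y P a : R) : x <= P * a + y -> y <= x / 2 -> x / 2 <= P * a.
Proof. lra. Qed.

Lemma card_bigcup_ord (X : finType) N (F : 'I_N -> {set X}) :
  (#|\bigcup_i F i| <= \sum_i #|F i|)%N.
Proof.
elim/big_rec2: _ => [|i m A _ h]; first by rewrite cards0.
by apply: leq_trans (leq_card_setU _ _) _; rewrite leq_add2l.
Qed.

(** Alternation fails only at slopes within [th] of the slope of the displacement (x, y); for a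
    vertical displacement it never fails. *)
Lemma bad_slope (x y m th : R) : (x, y) <> (0, 0) -> 0 < th ->
  ~~ ((th * `|x| <= `|y - x * m|) && (y - x * m != 0)) -> `|y / x - m| <= th.
Proof.
move=> xy th0; have [x0|x0] := eqVneq x 0.
  rewrite x0 normr0 mulr0 normr_ge0 mul0r subr0 negbK => /eqP y0.
  by case: xy; rewrite x0 y0.
have -> : y / x - m = (y - x * m) / x by field.
rewrite normrM normfV ler_pdivrMr ?normr_gt0// negb_and -ltNge negbK.
case/orP => [/ltW//|/eqP ->]; rewrite normr0 mulr_ge0//; lra.
Qed.

(** The gain [g] is chosen from [rho] and [D0] alone, before the assignment of centres, so the step
    can be repeated until the area is below [D0]. *)
Lemma refine_hit (Z : set T) B pa pb (ps : perfect_system Z B pa pb) (rho D0 : R) :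
  0 < rho <= 1 / 8 -> 0 < D0 -> exists2 g : R, 0 < g &
  forall N z dl n eta, (0 < N)%N -> (forall f, Z (z f)) -> 0 < dl ->
    (0 < n)%N -> 0 < eta ->
    D0 * n%:R ^+ 2 <= #|hit n (swept pa pb (right_times rho) N z dl)|%:R ->
  exists k z' dl' n',
  [/\ (0 < k)%N, forall f, Z (z' f), forall f, B eta (z (f %/ k)%N) (z' f) &
   [/\ 0 < dl', (0 < n')%N &
    #|hit n' (swept pa pb (right_times rho) (N * k) z' dl')|%:R / n'%:R ^+ 2 <=
    #|hit n (swept pa pb (right_times rho) N z dl)|%:R / n%:R ^+ 2 - g]].
Proof.
move=> /[dup] hrho /andP[rho0 rho1] D00.
(* [K] makes the phases finer than rho/16; [M] is so large that the cells near more than [M]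
   intervals fill at most half of the area [D0]. *)
have [K [K0 hK _ _ _]] := exists_nat_ge4 (16 / rho) 0 0 0.
have [M [M0 hM _ _ _]] := exists_nat_ge4 (4 / D0) 0 0 0.
have K0' : 0 < K%:R :> R by rewrite ltr0n.
have hK' : K%:R^-1 <= rho / 16.
  by rewrite -[leRHS]invf_div lef_pV2 ?posrE// divr_gt0.
have P0 : 0 < (K ^ M)%:R :> R by rewrite ltr0n expn_gt0 K0.
pose g := D0 / (4 * (K ^ M)%:R).
have gE : g = D0 / (4 * (K ^ M)%:R) by [].
have g0 : 0 < g by rewrite divr_gt0// mulr_gt0.
clearbody g.
exists g => // N z dl n eta N0 hz dl0 n0 eta0 hD.
have N0' : 0 < N%:R :> R by rewrite ltr0n.
(* On a bad slope interval the two centres lie almost on a common segment, so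
   alternating gains nothing; the bad slopes have measure at most 4 N theta. *)
pose theta := g / (12 * N%:R).
have thE : theta = g / (12 * N%:R) by [].
have th0 : 0 < theta by rewrite divr_gt0// mulr_gt0.
clearbody theta.
(* The slope intervals are so short that the horizontal displacement hardly changes the offset of
   the two centres within one of them. *)
have [k1 [k10 hk1 _ _ _]] := exists_nat_ge4 (32 / (theta * rho)) 0 0 0.
pose Q := (N * k1)%N.
have Q0 : (0 < Q)%N by rewrite muln_gt0 N0.
have Q0' : 0 < Q%:R :> R by rewrite ltr0n.
have hQ : Q%:R^-1 <= theta * rho / 32.
  rewrite -[leRHS]invf_div lef_pV2 ?posrE // ?divr_gt0 ?mulr_gt0//.
  by apply: le_trans hk1 _; rewrite ler_nat leq_pmull.
have hQt : Q%:R^-1 <= theta.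
  apply: le_trans hQ _; rewrite -mulrA ger_pMr//.
  by rewrite ler_pdivrMr//; lra.
have [dl1 [dl10 hd1 hd2 hd3 hd4]] := exists_pos_le4
  (divr_gt0 dl0 (ltr0Sn R 1)) eta0 (divr_gt0 (ltr01 : 0 < 1 :> R)
  (mulr_gt0 (ltr0Sn R 63) Q0')) (divr_gt0 rho0 (ltr0Sn R 7)).
have [z1 hz1] := choice (fun i => ps_perf ps dl10 (hz i)).
pose mq q : R := q%:R / Q%:R - 1 / 2.
pose u1 i := pa (z1 i) - pa (z i); pose u2 i := pb (z1 i) - pb (z i).
pose s q := u2 (q %/ k1)%N - u1 (q %/ k1)%N * mq q.
pose good q := (theta * `|u1 (q %/ k1)%N| <= `|s q|) && (s q != 0).
(* [s q] is the offset of the second centre from the line of slope [mq q] through the first. The two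
   are ordered so that c1 lies below the line through c0, and [h] is chosen to make [rho * h] this
   offset. *)
pose c0 q := if s q < 0 then z (q %/ k1)%N else z1 (q %/ k1)%N.
pose c1 q := if s q < 0 then z1 (q %/ k1)%N else z (q %/ k1)%N.
pose v1 q := pa (c1 q) - pa (c0 q); pose v2 q := pb (c1 q) - pb (c0 q).
pose h q := `|s q| / rho.
have sE q : v2 q - v1 q * mq q = - (rho * h q).
  rewrite /h mulrCA divff ?gt_eqF// mulr1 /v1 /v2 /c0 /c1 /s /u1 /u2.
  rewrite -/(u1 (q %/ k1)%N) -/(u2 (q %/ k1)%N) -/(s q).
  case: ltP => s0; rewrite ?(ltr0_norm s0) ?(ger0_norm s0) /s /u1 /u2; lra.
have Bz1 q : B dl1 (z q) (z1 q) by have [_ ? _] := hz1 q.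
have Bz q : B dl1 (z q) (z q) by apply: ps_refl; [exact: ps|exact: ltW].
have Bc0 q : B dl1 (z (q %/ k1)%N) (c0 q) by rewrite /c0; case: ifP.
have Bc1 q : B dl1 (z (q %/ k1)%N) (c1 q) by rewrite /c1; case: ifP.
have Zc0 q : Z (c0 q) by rewrite /c0; case: ifP => // _; have [] := hz1 (q %/ k1)%N.
have Zc1 q : Z (c1 q) by rewrite /c1; case: ifP => // _; have [] := hz1 (q %/ k1)%N.
have v1E q : `|v1 q| = `|u1 (q %/ k1)%N|.
  by rewrite /v1 /c0 /c1; case: ifP => // _; rewrite distrC.
have v2E q : `|v2 q| = `|u2 (q %/ k1)%N|.
  by rewrite /v2 /c0 /c1; case: ifP => // _; rewrite distrC.
have v1K q : pa (c0 q) + v1 q = pa (c1 q) by rewrite addrC subrK.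
have v2K q : pb (c0 q) + v2 q = pb (c1 q) by rewrite addrC subrK.
have v1le q : `|v1 q| <= dl1 by rewrite v1E; exact: (ps_pa ps (Bz1 _)).
have v2le q : `|v2 q| <= dl1 by rewrite v2E; exact: (ps_pb ps (Bz1 _)).
have rhE q : rho * h q = `|s q| by rewrite /h mulrCA divff ?gt_eqF// mulr1.
have mqb q : (q < Q)%N -> `|mq q| <= 1 / 2.
  move=> qQ; rewrite /mq.
  have : 0 <= q%:R / Q%:R :> R by rewrite divr_ge0.
  have : q%:R / Q%:R <= 1 :> R by rewrite ler_pdivrMr// mul1r ler_nat ltnW.
  by move=> x1 x0; rewrite ler_norml; clear - x0 x1; apply/andP; split; lra.
have sle q : (q < Q)%N -> `|s q| <= 2 * dl1.
  move=> /mqb mb; rewrite (le_trans (ler_normB _ _))// -v2E normrM -v1E.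
  have : `|v1 q| * `|mq q| <= dl1 * 1.
    by rewrite ler_pM//; apply: le_trans mb _; clear - R; lra.
  have := v2le q; clear - R; lra.
(* A common lower bound for the offsets on the finitely many good intervals; the finer slopes, the
   thickness and the grid are chosen relative to it. *)
have [sm [sm0 hsm]] : exists sm, 0 < sm /\
    forall q, (q < Q)%N -> sm <= if good q then `|s q| else 1.
  apply: exists_min_pos => q; case: ifP => // /andP[_ sn].
  by rewrite normr_gt0.
have [k2 [k20 hk2 _ _ _]] := exists_nat_ge4 (64 / sm) 0 0 0.
have Qk20 : (0 < Q * k2)%N by rewrite muln_gt0 Q0.
(* The three bounds keep the new sweep inside the old one, keep the error small against the comb
   period, and keep the bad fans thin. *)
have [dl2 [dl20 he1 he2 he3 _]] := exists_pos_le4 dl10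
  (divr_gt0 (mulr_gt0 sm0 rho0) (ltr0Sn R 127))
  (divr_gt0 g0 (mulr_gt0 (ltr0Sn R 23) N0')) ltr01.
have [p [p0 hp1 hp2 hp3 hp4]] :=
  exists_nat_ge4 4 (12 * Q%:R) (18 * N%:R / g) (64 / (rho * sm)).
pose n' := (n * p)%N.
have n'0 : (0 < n')%N by rewrite muln_gt0 n0.
have pn' : p%:R <= n'%:R :> R by rewrite ler_nat leq_pmull.
pose near (q : 'I_Q) : pred ('I_(4 * n') * 'I_(4 * n')) := fun ij =>
  ij \in hit n' (fan_pts (pa (z (q %/ k1)%N)) (pb (z (q %/ k1)%N)) (mq q)
    Q%:R^-1 (1 / 2) (2 * dl1)).
pose comb q (j : nat) := comb_pts rho (pa (c0 q)) (pb (c0 q)) (v1 q) (v2 q) (mq q)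
  (h q) Q%:R^-1 (Q * k2)%:R^-1 dl2 (j%:R / K%:R).
pose bad (q : 'I_Q) (j : 'I_K) : pred ('I_(4 * n') * 'I_(4 * n')) := fun ij =>
  good q && (ij \in hit n' (comb q j)).
have hav ij q : exists j, ~~ bad q j ij.
  case: (boolP (good q)) => gq; last by exists (Ordinal K0); rewrite /bad (negPf gq).
  have := hsm q (ltn_ord q); rewrite gq => sq.
  have s0 : 0 < `|s q| by apply: lt_le_trans sm0 sq.
  suff [j hj] : exists j : 'I_K, ij \notin hit n' (comb q j).
    by exists j; rewrite /bad gq.
  have [/andP[a1 _] /andP[b1 _]] := ps_itv ps (Zc0 q).
  apply: (comb_avoid ij n'0 hrho _ (sE q) _ _ _ _ _ a1 b1 K0 hK').
  - rewrite divr_gt0//= ler_pdivrMr// mul1r (le_trans (sle _ (ltn_ord q)))//.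
    clear - hd4 rho0; lra.
  - have := v1le q; clear - hd4 he1 rho0; lra.
  - have := v2le q; clear - hd4 he1 rho0; lra.
  - rewrite expr2 -(mulrA rho rho) rhE.
    apply: (@le_trans _ _ (`|v1 q| * (theta * rho / 32))); first by rewrite ler_wpM2l.
    rewrite v1E; move: gq => /andP[gq _].
    have : (theta * `|u1 (q %/ k1)%N|) * rho <= `|s q| * rho by rewrite ler_pM2r.
    clear - R; lra.
  - rewrite rhE; apply: (@le_trans _ _ (sm / 64)); last by clear - sq; lra.
    rewrite -[leRHS]invf_div lef_pV2 ?posrE ?ltr0n ?divr_gt0//.
    by apply: le_trans hk2 _; rewrite ler_nat leq_pmull.
  - rewrite rhE ler_pdivrMr//.
    have : sm * rho <= `|s q| * rho by rewrite ler_pM2r.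
    clear - he2; lra.
  - rewrite rhE ler_pdivrMr// ler_pdivrMr ?ltr0n// -ler_pdivrMl; last first.
      by rewrite mulr_gt0// divr_gt0.
    apply: le_trans pn'; apply: le_trans hp4.
    have -> : (`|s q| / 16 * rho)^-1 * 4 = 64 / (rho * `|s q|).
      by field; rewrite !gt_eqF.
    by rewrite ler_pM2l// lef_pV2 ?posrE ?mulr_gt0// ler_pM2l.
have hnear ij q j : bad q j ij -> near q ij.
  move=> /andP[_ /hitP[x [hx e1 e2]]]; apply/hitP; exists x; split => //.
  apply: comb_sub_fan hx => //.
  - exact: (ps_pa ps (Bc0 q)).
  - by rewrite v1K; exact: (ps_pa ps (Bc1 q)).
  - exact: (ps_pb ps (Bc0 q)).
  - by rewrite v2K; exact: (ps_pb ps (Bc1 q)).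
have [G [cG hG]] := subgrid (hit n (swept pa pb (right_times rho) N z dl)) p0.
have [w hw] := exists_avoiding_choice M G K0 hav hnear.
(* The default 0 concerns only indices from [Q] on, which no [u] in [0, 1) reaches. *)
pose ww q := if insub q is Some q' then nat_of_ord (w q') else 0%N.
pose phi f := let q := (f %/ k2)%N in
  (f%:R / (Q * k2)%:R - 1 / 2 - mq q) / (2 * h q) - (ww q)%:R / K%:R.
pose z' f := let q := (f %/ k2)%N in
  if good q then
    if phi f - (Num.floor (phi f))%:~R < 1 / 2 then c0 q else c1 q
  else z (q %/ k1)%N.
have Bz' f : B dl1 (z (f %/ (k1 * k2))%N) (z' f).
  by rewrite mulnC divnMA /z'; case: ifP => // _; case: ifP.
have Zz' f : Z (z' f) by rewrite /z'; case: ifP => // _; case: ifP.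
exists (k1 * k2)%N, z', dl2, n'.
split=> //; first by rewrite muln_gt0 k10.
  by move=> f; apply: (ps_mono ps) (Bz' f).
split => //.
set H := hit n' _.
pose mst i := u2 i / u1 i.
pose bf i := hit n' (fan_pts (pa (z i)) (pb (z i)) (mst i - 2 * theta)
  (4 * theta) (1 / 2) dl2).
set avoid := [set x in G | [forall q, ~~ bad q (w q) x]] in hw.
(* At a good slope the point lies in the old sweep and is hit in the chosen phase, so its cell is
   not avoided. At a bad slope it lies in a fan of slopes of width [4 * theta] around the slope of
   the displacement. *)
have Hsub : H \subset (G :\: avoid) :|: \bigcup_(i < N) bf i.
  apply/fintype.subsetP => ij /hitP[x [+ e1 e2]].
  move=> [u [t [b1 [b2 [/andP[hu0 hu1] ht hb1 hb2]]]]].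
  rewrite mulnA -/Q; set f := idx _ u => xE.
  have fq : (f %/ k2)%N = idx Q u by rewrite idx_div.
  have qi : (idx Q u %/ k1)%N = idx N u by rewrite idx_div.
  have qQ : (idx Q u < Q)%N by rewrite -[ltnRHS]mul1n idx_lt.
  have iN : (idx N u < N)%N by rewrite -[ltnRHS]mul1n idx_lt.
  have ub : `|u - 1 / 2| <= 1 / 2.
    by rewrite ler_norml; clear - hu0 hu1; apply/andP; split; lra.
  have mqu := slope_itv Q0 hu0; rewrite -/(mq _) in mqu.
  have ht2 : `|t| <= 1 / 2.
    by case/andP: ht => y1 y2; rewrite ger0_norm//; clear - rho0 y1 y2; lra.
  have ub1 : `|u - 1 / 2| <= 1 by apply: le_trans ub _; clear - R; lra.
  rewrite finset.in_setU; case: (boolP (good (idx Q u))) => gq; last first.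
    apply/orP; right; apply/bigcupP; exists (Ordinal iN) => //.
    apply/hitP; exists x; split => //; exists (u - 1 / 2), t, b1, b2; split => //.
      have hne : (u1 (idx N u), u2 (idx N u)) <> (0, 0).
        have [_ _ ne] := hz1 (idx N u); move=> [] /eqP; rewrite subr_eq0 => /eqP ea.
        by move=> /eqP; rewrite subr_eq0 => /eqP eb; apply: ne; rewrite ea eb.
      move: gq; rewrite /good /s qi => /(bad_slope hne th0).
      rewrite -/(mst _) ler_norml => /andP[y1 y2]; move: mqu => /andP[y3 y4].
      by clear - y1 y2 y3 y4 hQt; apply/andP; split; lra.
    by split => //; rewrite xE /z' fq (negPf gq) qi.
  apply/orP; left; rewrite finset.in_setD; apply/andP; split.
    rewrite finset.in_set negb_and; apply/orP; right.
    rewrite negb_forall; apply/existsP; exists (Ordinal qQ).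
    rewrite negbK /bad gq; apply/hitP; exists x; split => //.
    exists (u - 1 / 2), (f%:R / (Q * k2)%:R - 1 / 2), t, b1, b2; split => //.
      exact: slope_itv.
    split => //=; rewrite xE /z' fq gq /phi fq.
    have -> : ww (idx Q u) = w (Ordinal qQ) by rewrite /ww insubT.
    by case: ifP => _; rewrite ?addr0// v1K v2K.
  have Bf : B dl1 (z (idx N u)) (z' f) by have := Bz' f; rewrite mulnC divnMA fq qi.
  have [/andP[a1 a2] /andP[a3 a4]] := ps_itv ps (Zz' f).
  have small : dl2 <= 1 / 64 by clear - he1 hd4 rho1; lra.
  have x1 : 0 <= x.1 < 4%:R.
    have /ler_normlP[y1 y2] := hb1; have /andP[y3 y4] := ht.
    by rewrite xE /=; clear - a1 a2 y1 y2 y3 y4 small rho0; apply/andP; split; lra.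
  have x2 : 0 <= x.2 < 4%:R.
    have : `|t * (u - 1 / 2)| <= 1 / 2 * 1 by rewrite normrM ler_pM.
    move=> /ler_normlP[y1 y2]; have /ler_normlP[y3 y4] := hb2.
    by rewrite xE /=; clear - a3 a4 y1 y2 y3 y4 small; apply/andP; split; lra.
  have {x1} /andP[x10 x14] := x1; have {x2} /andP[x20 x24] := x2.
  apply: (hG _ (Ordinal (idx_lt x10 x14 n0), Ordinal (idx_lt x20 x24 n0))).
  - apply/hitP; exists x; split => //.
    exists u, t, (pa (z' f) - pa (z (idx N u)) + b1),
      (pb (z' f) - pb (z (idx N u)) + b2); split; rewrite ?hu0 ?hu1//.
    + rewrite (le_trans (ler_normD _ _))//.
      by have := ps_pa ps Bf; clear - hb1 hd1 he1; lra.
    + rewrite (le_trans (ler_normD _ _))//.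
      by have := ps_pb ps Bf; clear - hb2 hd1 he1; lra.
    + by rewrite xE; congr pair; ring.
  - by rewrite -e1 /= idx_div.
  - by rewrite -e2 /= idx_div.
(* Angle, thickness and rounding contribute at most a third each. *)
have cbad : #|\bigcup_(i < N) bf i|%:R <= g * n'%:R ^+ 2 :> R.
  apply: (@le_trans _ _ (\sum_(i < N) #|bf i|%:R)).
    by rewrite -natr_sum ler_nat card_bigcup_ord.
  apply: (@le_trans _ _ (\sum_(i < N)
      (2 * n'%:R * (n'%:R * (1 / 2 * (4 * theta) + 4 * dl2) + 3)))).
    apply: ler_sum => i _; apply: card_fan => //.
    - by rewrite -(ler_nat R) (le_trans hp1).
    - by have [/andP[]] := ps_itv ps (hz i).
    - by rewrite mulr_ge0// ltW.
    - by clear - R; apply/andP; split; lra.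
    - by clear - he1 dl20 hd4 rho1; apply/andP; split; lra.
  rewrite sumr_const card_ord -[leLHS]mulr_natl thE.
  have h1 : N%:R * dl2 <= g / 24.
    rewrite mulrC -ler_pdivlMr//; apply: le_trans he3 _.
    by rewrite le_eqVlt; apply/orP; left; apply/eqP; field; rewrite gt_eqF.
  have h2 : 18 * N%:R <= g * n'%:R.
    by rewrite -ler_pdivrMl// [leLHS]mulrC (le_trans hp3).
  rewrite (_ : N%:R * _ = (n'%:R ^+ 2) * (g / 3) + 8 * (n'%:R ^+ 2 * (N%:R * dl2)) +
    n'%:R * (6 * N%:R)); last by field; rewrite gt_eqF.
  have : n'%:R ^+ 2 * (N%:R * dl2) <= n'%:R ^+ 2 * (g / 24).
    by rewrite ler_wpM2l// exprn_ge0.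
  have : n'%:R * (18 * N%:R) <= n'%:R * (g * n'%:R) by rewrite ler_wpM2l.
  by clear - R; lra.
(* With multiplicity the fans meet at most 2 n'^2 cells, whatever [Q] is; Markov's inequality gives
   the rest. *)
have chigh : (#|[set x | (M < #|[set q | near q x]|)%N]|%:R : R)
    <= D0 * n'%:R ^+ 2 / 2.
  have := card_high M near; rewrite -(ler_nat R) natrM => hc.
  have {}hc : M.+1%:R * #|[set x | (M < #|[set q | near q x]|)%N]|%:R <=
      2 * n'%:R ^+ 2 :> R.
    apply: le_trans hc _; rewrite natr_sum.
    apply: (@le_trans _ _ (\sum_(q < Q)
      (2 * n'%:R * (n'%:R * (1 / 2 * Q%:R^-1 + 4 * (2 * dl1)) + 3)))).
      apply: ler_sum => q _.
      rewrite (_ : [set x | near q x] = hit n' (fan_pts (pa (z (q %/ k1)%N))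
        (pb (z (q %/ k1)%N)) (mq q) Q%:R^-1 (1 / 2) (2 * dl1))); last first.
        by apply/finset.setP => x; rewrite finset.in_set.
      apply: card_fan => //.
      - by rewrite -(ler_nat R) (le_trans hp1).
      - by have [/andP[]] := ps_itv ps (hz (q %/ k1)%N).
      - by clear - R; apply/andP; split; lra.
      - by clear - dl10 hd4 rho1; apply/andP; split; lra.
    rewrite sumr_const card_ord -[leLHS]mulr_natl.
    have h1 : Q%:R * dl1 <= 1 / 64.
      rewrite mulrC -ler_pdivlMr//; apply: le_trans hd3 _.
      by rewrite le_eqVlt; apply/orP; left; apply/eqP; field; rewrite gt_eqF.
    have h2 : 12 * Q%:R <= n'%:R :> R by apply: le_trans hp2 pn'.
    rewrite (_ : Q%:R * _ = (n'%:R ^+ 2) + 16 * (n'%:R ^+ 2 * (Q%:R * dl1)) +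
      n'%:R * (6 * Q%:R)); last by field; rewrite gt_eqF.
    have : n'%:R ^+ 2 * (Q%:R * dl1) <= n'%:R ^+ 2 * (1 / 64).
      by rewrite ler_wpM2l// exprn_ge0.
    have : n'%:R * (12 * Q%:R) <= n'%:R * n'%:R :> R by rewrite ler_wpM2l.
    have : 0 <= n'%:R ^+ 2 :> R by rewrite exprn_ge0.
    by clear - R; lra.
  have hM' : 4 <= D0 * M.+1%:R.
    rewrite mulrC -ler_pdivrMr//; apply: le_trans hM _.
    by rewrite ler_nat.
  rewrite -(ler_pM2l (ltr0Sn R M)); apply: le_trans hc _.
  have : 4 * n'%:R ^+ 2 <= (D0 * M.+1%:R) * n'%:R ^+ 2.
    by rewrite ler_wpM2r// exprn_ge0.
  by clear - R; lra.
have avG : avoid \subset G.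
  by apply/fintype.subsetP => x; rewrite finset.in_set => /andP[].
have n2 : 0 < n'%:R ^+ 2 :> R by rewrite exprn_gt0// ltr0n.
have cGE : #|G|%:R / n'%:R ^+ 2 =
    #|hit n (swept pa pb (right_times rho) N z dl)|%:R / n%:R ^+ 2 :> R.
  rewrite cG /n' !natrM exprMn; field.
  by rewrite !pnatr_eq0 -!lt0n n0 p0.
rewrite -cGE ler_pdivrMr// mulrBl divfK ?gt_eqF//.
apply: (@gain_count (K ^ M)%:R D0 g #|G|%:R #|avoid|%:R
  #|\bigcup_(i < N) bf i|%:R) => //.
  apply: half_le chigh; apply: (@le_trans _ _ #|G|%:R).
    by rewrite -ler_pdivlMr// cGE ler_pdivlMr// exprn_gt0// ltr0n.
  rewrite -natrM -natrD ler_nat; apply: leq_trans (leq_add hw (leqnn _)).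
  apply: leq_trans (leq_card_setU _ _); apply: subset_leq_card.
  by apply/fintype.subsetP => x xG; rewrite !inE xG /=; case: leqP.
have : (#|H| <= #|G :\: avoid| + #|\bigcup_(i < N) bf i|)%N.
  by apply: leq_trans (subset_leq_card Hsub) (leq_card_setU _ _).
have -> : (#|G :\: avoid| = #|G| - #|avoid|)%N.
  by rewrite cardsD (finset.setIidPr avG).
rewrite -(ler_nat R) natrD natrB //.
by rewrite subset_leq_card.
Qed.

End Reduce.

(** * Small planar covers *)

Section SquareCover.
Variable R : realType.

(* A triple (x, y, s) stands for the square [x, x + s] x [y, y + s]. *)
Definition sq_cover (eps : R) (S : set (R * R)) : Prop :=
  exists s : seq (R * R * R),
  [/\ forall b, b \in s -> 0 <= b.2,
      forall p, S p -> exists2 b, b \in s &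
        b.1.1 <= p.1 <= b.1.1 + b.2 /\ b.1.2 <= p.2 <= b.1.2 + b.2 &
      \sum_(b <- s) b.2 ^+ 2 <= eps].

Lemma sq_coverS eps (S S' : set (R * R)) : (S `<=` S')%classic ->
  sq_cover eps S' -> sq_cover eps S.
Proof. by move=> SS' [s [h1 h2 h3]]; exists s; split => // p /SS' /h2. Qed.

Lemma sq_coverU e1 e2 (S S' : set (R * R)) : sq_cover e1 S -> sq_cover e2 S' ->
  sq_cover (e1 + e2) (S `|` S')%classic.
Proof.
move=> [s [h1 h2 h3]] [s' [h1' h2' h3']]; exists (s ++ s'); split.
- by move=> b; rewrite mem_cat => /orP[/h1|/h1'].
- move=> p [/h2[b bs hb]|/h2'[b bs hb]]; exists b.
  + by rewrite mem_cat bs.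
  + exact: hb.
  + by rewrite mem_cat bs orbT.
  + exact: hb.
- by rewrite big_cat lerD.
Qed.

(** The point reflection of [0, 4]^2 exchanges right and left halves of segments. *)
Lemma sq_cover_reflect eps (S : set (R * R)) : sq_cover eps S ->
  sq_cover eps [set p | S (4 - p.1, 4 - p.2)]%classic.
Proof.
move=> [s [h1 h2 h3]].
exists [seq (4 - b.1.1 - b.2, 4 - b.1.2 - b.2, b.2) | b <- s]; split.
- by move=> _ /mapP[b bs ->] /=; exact: h1 bs.
- move=> p /h2[b bs /= [/andP[? ?] /andP[? ?]]].
  exists (4 - b.1.1 - b.2, 4 - b.1.2 - b.2, b.2).
    by apply/mapP; exists b.
  by split => /=; apply/andP; split; lra.
- by rewrite big_map.
Qed.

Lemma sq_cover_hit eps n (S : set (R * R)) : (0 < n)%N ->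
  (forall p, S p -> 0 <= p.1 < 4 /\ 0 <= p.2 < 4) ->
  #|hit n S|%:R <= eps * n%:R ^+ 2 -> sq_cover eps S.
Proof.
move=> n0 hS hc.
have n0' : 0 < n%:R :> R by rewrite ltr0n.
exists [seq (ij.1%:R / n%:R, ij.2%:R / n%:R, n%:R^-1) |
  ij : 'I_(4 * n) * 'I_(4 * n) <- enum (hit n S)].
split.
- by move=> _ /mapP[b _ ->]; rewrite invr_ge0.
- move=> p Sp; have [/andP[a1 a2] /andP[b1 b2]] := hS _ Sp.
  have i1 : (idx n p.1 < 4 * n)%N by rewrite idx_lt.
  have i2 : (idx n p.2 < 4 * n)%N by rewrite idx_lt.
  exists ((idx n p.1)%:R / n%:R, (idx n p.2)%:R / n%:R, n%:R^-1).
    apply/mapP; exists (Ordinal i1, Ordinal i2) => //.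
    by rewrite mem_enum; apply/hitP; exists p.
  have loc x : 0 <= x ->
      (idx n x)%:R / n%:R <= x <= (idx n x)%:R / n%:R + n%:R^-1.
    by move=> x0; have := slope_itv n0 x0; lra.
  by split; apply: loc.
- rewrite big_map big_enum /= sumr_const exprVn -[leLHS]mulr_natr mulrC.
  by rewrite ler_pdivrMr ?exprn_gt0.
Qed.
End SquareCover.

(** * Iterating the reduction and covering whole segments *)

Section Stage.
Variables (R : realType) (T : Type) (Z : set T) (B : R -> T -> T -> Prop).

(** A cover found at one stage survives all later stages whose displacements fit into its
    thickness. *)
Lemma swept_sub pa pb I N k (z z' : nat -> T) r dl dl' :
  perfect_system Z B pa pb -> (0 < k)%N ->
  (forall f, B r (z (f %/ k)%N) (z' f)) -> r + dl' <= dl ->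
  (swept pa pb I (N * k) z' dl' `<=` swept pa pb I N z dl)%classic.
Proof.
move=> ps k0 hB hdl x [u [t [d1 [d2 [/andP[u0 u1] It hd1 hd2 ->]]]]].
set f := idx _ u; have fu : (f %/ k)%N = idx N u by rewrite idx_div.
exists u, t, (pa (z' f) - pa (z (idx N u)) + d1),
  (pb (z' f) - pb (z (idx N u)) + d2).
have := hB f; rewrite fu => hf.
split; rewrite ?u0 ?u1//.
- rewrite (le_trans (ler_normD _ _))//; apply: le_trans hdl.
  by rewrite lerD// (ps_pa ps).
- rewrite (le_trans (ler_normD _ _))//; apply: le_trans hdl.
  by rewrite lerD// (ps_pb ps).
- by congr pair; ring.
Qed.

Lemma swept_itv pa pb (I : set R) N (z : nat -> T) dl : perfect_system Z B pa pb ->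
  (forall t, I t -> `|t| <= 1 / 2) -> dl <= 1 / 4 -> (forall f, Z (z f)) ->
  forall p, swept pa pb I N z dl p -> 0 <= p.1 < 4 /\ 0 <= p.2 < 4.
Proof.
move=> ps hI hdl hz p [u [t [d1 [d2 [/andP[u0 u1] /hI It hd1 hd2 ->]]]]] /=.
have [/andP[a1 a2] /andP[a3 a4]] := ps_itv ps (hz (idx N u)).
have : `|t * (u - 1 / 2)| <= 1 / 2 * 1.
  by rewrite normrM ler_pM// ler_norml; apply/andP; split; lra.
move: hd1 hd2 It; rewrite !ler_norml.
move=> /andP[? ?] /andP[? ?] /andP[? ?] /andP[? ?].
by split; apply/andP; split; lra.
Qed.

Lemma perfect_system_reflect pa pb : perfect_system Z B pa pb ->
  perfect_system Z B (fun z => 4 - pa z) (fun z => 4 - pb z).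
Proof.
move=> ps; have e (x y : R) : `|4 - x - (4 - y)| = `|x - y|.
  by rewrite distrC; congr (`|_|); ring.
split.
- exact: ps_refl ps.
- exact: ps_trans ps.
- exact: ps_mono ps.
- by move=> r x y hB; rewrite e (ps_pa ps).
- by move=> r x y hB; rewrite e (ps_pb ps).
- move=> z /(ps_itv ps)[/andP[? ?] /andP[? ?]].
  by split; apply/andP; split; lra.
- move=> r z r0 /(ps_perf ps r0)[z' [Zz' Bz' ne]]; exists z'; split => //.
  by case=> e1 e2; apply: ne; congr pair; lra.
Qed.

(** The area starts at no more than 16, that of [0, 4)^2, and drops by a fixed [g] as long as it
    exceeds [eps]. *)
Lemma refine_right_cover pa pb rho eps : perfect_system Z B pa pb ->
  0 < rho <= 1 / 8 -> 0 < eps ->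
  forall N z eta, (0 < N)%N -> (forall f, Z (z f)) -> 0 < eta ->
  exists k z' dl,
    [/\ (0 < k)%N, forall f, Z (z' f), forall f, B eta (z (f %/ k)%N) (z' f),
      0 < dl <= 1 / 4 & sq_cover eps (swept pa pb (right_times rho) (N * k) z' dl)].
Proof.
move=> ps hrho eps0.
have [g g0 hg] := refine_hit ps hrho eps0.
have step j N z eta : (0 < N)%N -> (forall f, Z (z f)) -> 0 < eta ->
  exists k z' dl n,
  [/\ (0 < k)%N, forall f, Z (z' f), forall f, B eta (z (f %/ k)%N) (z' f) &
   [/\ 0 < dl, (0 < n)%N &
    let r := #|hit n (swept pa pb (right_times rho) (N * k) z' dl)|%:R / n%:R ^+ 2 in
    r <= eps \/ r <= 16 - j%:R * g]].
  move=> N0 hz eta0; elim: j => [|j IH] in eta eta0 *.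
    exists 1%N, z, 1, 1%N; split => //.
      by move=> f; rewrite divn1; apply: (ps_refl ps); apply: ltW.
    split => //=; right; rewrite mul0r subr0 expr1n divr1 (ler_nat R _ 16).
    by rewrite (leq_trans (max_card _))// card_prod card_ord.
  (* Half of [eta] is spent on the earlier steps, half on the new one. *)
  have eta2 : 0 < eta / 2 by rewrite divr_gt0.
  have [k [z1 [dl [n [k0 hz1 hB1 [dl0 n0 /= h]]]]]] := IH _ eta2.
  have [hr|hr] := leP (#|hit n (swept pa pb (right_times rho) (N * k) z1 dl)|%:R
      / n%:R ^+ 2) eps.
    exists k, z1, dl, n; split=> //; last by split=> //; left.
    by move=> f; apply: (ps_mono ps) (hB1 f); rewrite ler_pdivrMr// ler_pMr// ler1n.
  case: h => [h|h]; first by rewrite ltNge h in hr.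
  have Nk0 : (0 < N * k)%N by rewrite muln_gt0 N0.
  have [|k' [z' [dl' [n' [k'0 hz' hB' [dl'0 n'0 hr']]]]]] :=
    hg (N * k)%N z1 dl n (eta / 2) Nk0 hz1 dl0 n0 eta2.
    by rewrite -ler_pdivlMr ?exprn_gt0 ?ltr0n// ltW.
  exists (k * k')%N, z', dl', n'; split => //; first by rewrite muln_gt0 k0.
    move=> f; rewrite mulnC divnMA [eta]splitr.
    exact: (ps_trans ps (hB1 _) (hB' f)).
  split => //=; right; rewrite mulnA; apply: le_trans hr' _.
  by rewrite -[j.+1%:R]natr1 mulrDl mul1r opprD addrA lerD2r.
move=> N z eta N0 hz eta0.
have [j [_ hj _ _ _]] := exists_nat_ge4 (17 / g) 0 0 0.
have [k [z' [dl [n [k0 hz' hB [dl0 n0 /= h]]]]]] := step j N z eta N0 hz eta0.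
have {}h : #|hit n (swept pa pb (right_times rho) (N * k) z' dl)|%:R / n%:R ^+ 2 <= eps.
  case: h => // h; exfalso.
  have : 0 <= #|hit n (swept pa pb (right_times rho) (N * k) z' dl)|%:R / n%:R ^+ 2 :> R.
    by rewrite divr_ge0// exprn_ge0.
  by move: hj; rewrite ler_pdivrMr//; lra.
(* Thickness at most 1/4 keeps the sweep in [0, 4)^2, where the cells cover it. *)
have [dl' [dl'0 h1 h2 _ _]] := exists_pos_le4 dl0
  (divr_gt0 (ltr01 : 0 < 1 :> R) (ltr0Sn R 3)) ltr01 ltr01.
exists k, z', dl'; split => //; first by rewrite dl'0.
apply: (@sq_cover_hit _ _ n) => //.
  apply: (swept_itv ps) => //.
  move=> t /andP[t1 t2]; rewrite ger0_norm//; case/andP: hrho => ? ?; lra.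
rewrite -ler_pdivrMr ?exprn_gt0 ?ltr0n//; apply: le_trans h.
rewrite ler_pM2r ?invr_gt0 ?exprn_gt0 ?ltr0n// ler_nat.
apply/subset_leq_card/fintype.subsetP => ij /hitP[p [hp e1 e2]].
apply/hitP; exists p; split => //; move: hp => [u [t [d1 [d2 [? ? ? ? ->]]]]].
by exists u, t, d1, d2; split => //; apply: le_trans h1.
Qed.

Definition segment_times : set R := [set t | `|t| <= 1 / 2]%classic.

(** The middle parts have total area of order [rho] for any number [N] of intervals, so [rho] is
    fixed first and only [dl] depends on [N]. *)
Lemma small_center_cover pa pb eps : perfect_system Z B pa pb -> 0 < eps ->
  exists rho, 0 < rho <= 1 / 8 /\
  forall N z, (0 < N)%N -> (forall f, Z (z f)) -> exists2 dl, 0 < dl &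
    sq_cover eps (swept pa pb [set t | `|t| <= 2 * rho]%classic N z dl).
Proof.
move=> ps eps0.
have [rho [rho0 r1 r2 _ _]] := exists_pos_le4
  (divr_gt0 (ltr01 : 0 < 1 :> R) (ltr0Sn R 7)) (divr_gt0 eps0 (ltr0Sn R 15))
  ltr01 ltr01.
exists rho; split; first by rewrite rho0.
move=> N z N0 hz; have N0' : 0 < N%:R :> R by rewrite ltr0n.
have [dl [dl0 h1 h2 _ _]] := exists_pos_le4
  (divr_gt0 (ltr01 : 0 < 1 :> R) (ltr0Sn R 3))
  (divr_gt0 eps0 (mulr_gt0 (ltr0Sn R 31) N0')) ltr01 ltr01.
have [n [n0 n4 n1 _ _]] := exists_nat_ge4 4 (24 * N%:R / eps) 0 0.
exists dl => //; apply: (@sq_cover_hit _ _ n) => //.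
  apply: (swept_itv ps) => //= t ht; apply: le_trans ht _.
  by clear - r1; lra.
pose fan (i : 'I_N) := hit n (fan_pts (pa (z i)) (pb (z i))
  (i%:R / N%:R - 1 / 2) N%:R^-1 (2 * rho) dl).
apply: (@le_trans _ _ #|\bigcup_i fan i|%:R).
  rewrite ler_nat; apply/subset_leq_card/fintype.subsetP => ij.
  move=> /hitP[x [hx e1 e2]]; apply/bigcupP.
  move: hx => [u [t [d1 [d2 [/andP[u0 u1] ht hd1 hd2 xE]]]]].
  have iN : (idx N u < N)%N by rewrite -[ltnRHS]mul1n idx_lt.
  exists (Ordinal iN) => //; apply/hitP; exists x; split => //.
  exists (u - 1 / 2), t, d1, d2; split => //; first exact: slope_itv.
  by rewrite ler_norml; clear - u0 u1; apply/andP; split; lra.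
apply: (@le_trans _ _ (\sum_(i < N) #|fan i|%:R)).
  by rewrite -natr_sum ler_nat card_bigcup_ord.
apply: (@le_trans _ _ (\sum_(i < N)
    (2 * n%:R * (n%:R * (2 * rho * N%:R^-1 + 4 * dl) + 3)))).
  apply: ler_sum => i _; apply: card_fan => //.
  - by rewrite -(ler_nat R).
  - by have [/andP[]] := ps_itv ps (hz i).
  - by clear - r1 rho0; apply/andP; split; lra.
  - by rewrite h1 ltW.
rewrite sumr_const card_ord -[leLHS]mulr_natl.
have h3 : N%:R * dl <= eps / 32.
  rewrite mulrC -ler_pdivlMr//; apply: le_trans h2 _.
  by rewrite le_eqVlt; apply/orP; left; apply/eqP; field; rewrite gt_eqF.
have h4 : 24 * N%:R <= eps * n%:R.
  by rewrite [leRHS]mulrC -ler_pdivrMr.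
rewrite (_ : N%:R * _ = n%:R ^+ 2 * (4 * rho) + 8 * (n%:R ^+ 2 * (N%:R * dl)) +
  n%:R * (6 * N%:R)); last by field; rewrite gt_eqF.
have : n%:R ^+ 2 * (N%:R * dl) <= n%:R ^+ 2 * (eps / 32).
  by rewrite ler_wpM2l// exprn_ge0.
have : n%:R ^+ 2 * rho <= n%:R ^+ 2 * (eps / 16).
  by rewrite ler_wpM2l// exprn_ge0.
have : n%:R * (24 * N%:R) <= n%:R * (eps * n%:R) by rewrite ler_wpM2l.
have : 0 <= n%:R ^+ 2 * eps by rewrite mulr_ge0 ?exprn_ge0// ltW.
by clear - R; lra.
Qed.

(** Refine for the right halves, then for the left halves through the reflected system, and add the
    middle parts; each costs [eps / 4]. *)
Lemma refine_cover pa pb eps : perfect_system Z B pa pb -> 0 < eps ->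
  forall N z eta, (0 < N)%N -> (forall f, Z (z f)) -> 0 < eta ->
  exists k z' dl,
    [/\ (0 < k)%N, forall f, Z (z' f), forall f, B eta (z (f %/ k)%N) (z' f),
      0 < dl & sq_cover eps (swept pa pb segment_times (N * k) z' dl)].
Proof.
move=> ps eps0 N z eta N0 hz eta0.
have e4 : 0 < eps / 4 by rewrite divr_gt0.
have [rho [hrho hcenter]] := small_center_cover ps e4.
have [k1 [z1 [dl1 [k10 hz1 hB1 /andP[dl10 _] hc1]]]] :=
  refine_right_cover ps hrho e4 N0 hz (divr_gt0 eta0 (ltr0Sn R 1)).
(* The second refinement moves centres by at most half of [dl1], so the cover of the right halves
   remains valid. *)
have [eta2 [eta20 h1 h2 _ _]] := exists_pos_le4
  (divr_gt0 eta0 (ltr0Sn R 1)) (divr_gt0 dl10 (ltr0Sn R 1)) ltr01 ltr01.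
have Nk10 : (0 < N * k1)%N by rewrite muln_gt0 N0.
have [k2 [z2 [dl2 [k20 hz2 hB2 /andP[dl20 _] hc2]]]] :=
  refine_right_cover (perfect_system_reflect ps) hrho e4 Nk10 hz1 eta20.
have Nk20 : (0 < N * k1 * k2)%N by rewrite muln_gt0 Nk10.
have [dl3 dl30 hc3] := hcenter _ z2 Nk20 hz2.
have [dl [dl0 h3 h4 h5 _]] := exists_pos_le4
  (divr_gt0 dl10 (ltr0Sn R 1)) dl20 dl30 ltr01.
exists (k1 * k2)%N, z2, dl; split => //; first by rewrite muln_gt0 k10.
  move=> f; rewrite mulnC divnMA [eta]splitr.
  apply: (ps_trans ps (hB1 _)); exact: (ps_mono ps _ (hB2 f)).
rewrite mulnA.
have {}hc1 : sq_cover (eps / 4) (swept pa pb (right_times rho) (N * k1 * k2) z2 dl).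
  apply: sq_coverS hc1; apply: (swept_sub ps k20 hB2).
  by clear - h2 h3; lra.
have {}hc2 := sq_cover_reflect hc2.
have [s [s1 s2 s3]] := sq_coverU (sq_coverU hc1 hc2) hc3.
exists s; split => //; last by apply: le_trans s3 _; clear - eps0; lra.
move=> x [u [t [d1 [d2 [hu ht hd1 hd2 ->]]]]]; apply: s2.
have /ler_normlP[t1 t2] := ht.
have [rt|rt] := leP (2 * rho) t.
  left; left; exists u, t, d1, d2; split => //.
  by apply/andP; split => //; clear - t2; lra.
have [tr|tr] := leP t (- (2 * rho)).
  left; right; exists u, (- t), (- d1), (- d2); rewrite !normrN; split => //.
  - by apply/andP; split; clear - tr t1; lra.
  - exact: le_trans h4.
  - exact: le_trans h4.
  - by congr pair => /=; ring.
right; exists u, t, d1, d2; split => //.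
- by rewrite /= ler_norml; clear - rt tr; apply/andP; split; lra.
- exact: le_trans h5.
- exact: le_trans h5.
Qed.

End Stage.

(** * Borel sets and condensation points *)

Local Open Scope classical_set_scope.
Local Open Scope ring_scope.

Section RowNorm.
Variables (R : realType) (d : nat).

Lemma row_norm_leP (x : 'rV[R]_d) (r : R) : 0 <= r ->
  `|x| <= r <-> forall i, `|x ord0 i| <= r.
Proof.
move=> r0; rewrite [`|x|]mx_normrE; split => [h i|h].
  by apply: le_trans h; apply: (le_bigmax _ _ (ord0, i)).
by apply: bigmax_le => // -[i j] _ /=; rewrite (ord1 i).
Qed.

End RowNorm.

Section Suslin.
Variables (R : realType) (d : nat).
Local Notation V := 'rV[R]_d.
Implicit Types (F : V -> (nat -> nat) -> Prop) (A : set V).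

(* Sequential closedness in the product of R^d with the Baire space. *)
Definition pclosed F : Prop := forall x s,
  (forall L : nat, exists y t, [/\ F y t, `|y - x| <= L.+1%:R^-1 &
     forall j, (j < L)%N -> s j = t j]) -> F x s.

(** The analytic sets. *)
Definition suslin A : Prop :=
  exists F, pclosed F /\ forall x, A x <-> exists s, F x s.

Lemma suslin_closed A : closed A -> suslin A.
Proof.
move=> cA; exists (fun x _ => A x); split; last first.
  by move=> x; split => [Ax|[]//]; exists (fun=> 0%N).
move=> x s h; apply: cA => U /nbhs_ballP[e /= e0 eU].
have [L [_ hL _ _]] : exists L : nat, [/\ True, e^-1 <= L%:R, True & True].
  by exists (Num.truncn e^-1).+1; split => //; apply/ltW/truncnS_gt.
have [y [t [Ay yx _]]] := h L; exists y; split => //; apply: eU.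
rewrite -ball_normE /= distrC (le_lt_trans yx)//.
by rewrite invf_plt ?posrE// (le_lt_trans hL)// ltr_nat.
Qed.

(** The first entry of the sequence witnesses a positive distance from the complement. *)
Lemma suslin_open A : open A -> suslin A.
Proof.
move=> oA; exists (fun x s => forall y, ~ A y -> (s 0%N).+1%:R^-1 <= `|y - x|); split.
  move=> x s h y Ay; apply/ler_addgt0Pr => e e0.
  have [L hL] : exists L : nat, e^-1 <= L%:R.
    by exists (Num.truncn e^-1).+1; apply/ltW/truncnS_gt.
  have [z [t [hz zx zs]]] := h L.+1.
  rewrite zs// (le_trans (hz y Ay))//.
  rewrite -[y - z](subrKA x) (le_trans (ler_normD _ _))// lerD2l distrC.
  apply: le_trans zx _; rewrite invf_ple ?posrE// (le_trans hL)// ler_nat.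
  by rewrite (leq_trans (leqnSn _)).
move=> x; split => [Ax|[s hs]]; last first.
  apply: contrapT => /hs; rewrite subrr normr0 => h0.
  by move: h0; rewrite leNgt invr_gt0 ltr0n.
have /nbhs_ballP[e /= e0 eA] := open_nbhs_nbhs (conj oA Ax).
exists (fun=> Num.truncn e^-1) => y nAy; rewrite leNgt; apply/negP => yx.
apply: nAy; apply: eA; rewrite -ball_normE /= distrC (lt_trans yx)//.
by rewrite invf_plt ?posrE// truncnS_gt.
Qed.

(** The first entry names the set of the union, the tail is the witness for it. *)
Lemma suslin_bigcup (A : nat -> set V) :
  (forall n, suslin (A n)) -> suslin (\bigcup_n A n).
Proof.
move=> hA.
have [F hF] := choice hA.
exists (fun x s => F (s 0%N) x (fun k => s k.+1)); split.
  move=> x s h; have [cF _] := hF (s 0%N); apply: cF => L.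
  have [y [t [Fy yx st]]] := h L.+1; exists y, (fun k => t k.+1).
  rewrite st//; split => //; last by move=> j jL; apply: st.
  by rewrite (le_trans yx)// lef_pV2 ?posrE// ler_nat.
move=> x; split.
  move=> [n _ /(hF n).2[s Fs]].
  by exists (fun k => if k is k'.+1 then s k' else n).
by move=> [s Fs]; exists (s 0%N) => //; apply/(hF _).2; exists (fun k => s k.+1).
Qed.

(** One sequence encodes witnesses for all the sets, through the pairing [pickle]. *)
Lemma suslin_bigcap (A : nat -> set V) :
  (forall n, suslin (A n)) -> suslin (\bigcap_n A n).
Proof.
move=> hA.
have [F hF] := choice hA.
exists (fun x s => forall n, F n x (fun k => s (pickle (n, k)))); split.
  move=> x s h n; have [cF _] := hF n; apply: cF => L.
  (* Long enough to contain the codes of the first [L] entries of the [n]-th witness. *)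
  pose L' := (L + \max_(k < L) (pickle (n, nat_of_ord k)).+1)%N.
  have [y [t [Fy yx st]]] := h L'; exists y, (fun k => t (pickle (n, k))).
  split => //.
    by rewrite (le_trans yx)// lef_pV2 ?posrE// ler_nat ltnS leq_addr.
  move=> j jL; apply: st; rewrite /L'; apply: leq_trans (leq_addl _ _).
  exact: (leq_bigmax (Ordinal jL)).
move=> x; split.
  move=> Ax; have [s hs] := choice (fun n => ((hF n).2 x).1 (Ax n I)).
  exists (fun m => if unpickle m is Some (n, k) then s n k else 0%N) => n.
  have -> // : (fun k => if unpickle (pickle (n, k)) is Some (n0, k0)
      then s n0 k0 else 0%N) = s n.
  by apply/funext => k; rewrite pickleK.
by move=> [s Fs] n _; apply/(hF n).2; exists (fun k => s (pickle (n, k))).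
Qed.

(** The sets that are analytic together with their complement form a sigma-algebra containing the
    open sets. *)
Lemma borel_suslin A : borel_set A -> suslin A.
Proof.
move=> bA; suff : [set A | suslin A /\ suslin (~` A)] A by case.
apply: smallest_sub bA; last first.
  move=> U oU; split; first exact: suslin_open.
  exact/suslin_closed/open_closedC.
split.
- split; first exact/suslin_closed/closed0.
  by rewrite classical_sets.setC0; apply/suslin_closed/closedT.
- by move=> B [B1 B2]; rewrite classical_sets.setTD; split => //; rewrite classical_sets.setCK.
- move=> B hB; split; first by apply: suslin_bigcup => n; case: (hB n).
  by rewrite setC_bigcup; apply: suslin_bigcap => n; case: (hB n).
Qed.

End Suslin.

Section Condensation.
Variables (R : realType) (d : nat).
Local Notation V := 'rV[R]_d.

(** Otherwise the set would embed into a finite power of a countable set. Working with one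
    coordinate makes nearby centres differ in the planar picture too. *)
Lemma uncountable_coordinate (A : set V) : ~ countable A ->
  exists l : 'I_d, ~ countable [set x ord0 l | x in A].
Proof.
move=> hA; apply: contrapT => hno; apply: hA.
have hc l : exists f : R -> nat, {in [set x ord0 l | x in A] &, injective f}.
  by apply/countable_injP; apply: contrapT => h; apply: hno; exists l.
have [f hf] := choice hc.
apply/countable_injP.
exists (fun x : V => pickle [ffun l : 'I_d => f l (x ord0 l)]) => x y.
rewrite !inE => Ax Ay /(pcan_inj pickleK) /ffunP e.
apply/rowP => l; have := e l; rewrite !ffunE; apply: hf; rewrite inE.
- by exists x.
- by exists y.
Qed.

(* On N^N the distance is 1 / (j + 1), where j is the first index at which the
   two sequences differ. *)
Definition seq_ball (r : R) (z z' : V * (nat -> nat)) : Prop :=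
  `|z'.1 - z.1| <= r /\
  forall k, r < k.+1%:R^-1 -> forall j, (j <= k)%N -> z.2 j = z'.2 j.

Lemma seq_ball_refl r z : 0 <= r -> seq_ball r z z.
Proof. by move=> r0; split => //; rewrite subrr normr0. Qed.

Lemma seq_ball_trans r s x y z :
  seq_ball r x y -> seq_ball s y z -> seq_ball (r + s) x z.
Proof.
move=> [xy1 xy2] [yz1 yz2]; split.
  by rewrite -[z.1 - x.1](subrKA y.1) addrC (le_trans (ler_normD _ _))// lerD.
have r0 : 0 <= r := le_trans (normr_ge0 _) xy1.
have s0 : 0 <= s := le_trans (normr_ge0 _) yz1.
move=> k hk j jk; transitivity (y.2 j).
  by apply: xy2 jk; apply: le_lt_trans hk; rewrite lerDl.
by apply: yz2 jk; apply: le_lt_trans hk; rewrite lerDr.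
Qed.

Lemma seq_ball_mono r s x y : r <= s -> seq_ball r x y -> seq_ball s x y.
Proof.
move=> rs [xy1 xy2]; split; first exact: le_trans rs.
by move=> k hk; apply: xy2; apply: le_lt_trans hk.
Qed.

(** A base of R^d x N^N with a countable index type. *)
Definition rat_box (b : {ffun 'I_d -> rat} * nat * seq nat) :
    set (V * (nat -> nat)) :=
  [set z : V * (nat -> nat) | (forall i, `|z.1 ord0 i - ratr (b.1.1 i)| < b.1.2.+1%:R^-1) /\
           forall j, (j < size b.2)%N -> z.2 j = nth 0%N b.2 j].

Lemma rat_box_small (z : V * (nat -> nat)) r : 0 < r ->
  exists b, rat_box b z /\ forall z', rat_box b z' -> seq_ball r z z'.
Proof.
move=> r0; pose K := (Num.truncn (2 / r)).+1.
have hK : 2 / r < K%:R by apply: truncnS_gt.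
clearbody K.
have K2 : 2 * K.+1%:R^-1 <= r.
  rewrite ler_pdivrMr// mulrC -ler_pdivrMr//.
  by rewrite (le_trans (ltW hK))// ler_nat.
have hc i : exists c : rat, `|z.1 ord0 i - ratr c| < K.+1%:R^-1.
  have /rat_in_itvoo[c] : z.1 ord0 i - K.+1%:R^-1 < z.1 ord0 i + K.+1%:R^-1.
    by rewrite ltrD2l gtrN// invr_gt0.
  rewrite in_itv /=; set e := _^-1 => /andP[? ?]; exists c; clearbody e.
  by rewrite ltr_norml; apply/andP; split; lra.
have [c cP] := choice hc.
exists ([ffun i => c i], K, mkseq z.2 K); split.
  split => /= [i|j]; first by rewrite ffunE.
  by rewrite size_mkseq => jK; rewrite nth_mkseq.
move=> z' [h1 h2]; split.
  apply/row_norm_leP; first exact: ltW.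
  move=> i; have := h1 i; have := cP i; rewrite /= ffunE !mxE.
  move: K2; set e := _^-1; clearbody e; rewrite !ltr_norml => K2 /andP[? ?] /andP[? ?].
  by rewrite ler_norml; apply/andP; split; lra.
move=> k rk j jk; have jK : (j < K)%N.
  have : 2 * K.+1%:R^-1 < k.+1%:R^-1 :> R by apply: le_lt_trans rk.
  rewrite ltr_pdivrMr// mulrC -ltr_pdivrMr ?invr_gt0// invrK.
  by rewrite -natrM ltr_nat; lia.
by have := h2 j; rewrite /= size_mkseq nth_mkseq// => ->.
Qed.

(* Z consists of the points of F all of whose neighbourhoods in F have an
   uncountable image under the l-th coordinate. *)
Lemma condensation (F : set (V * (nat -> nat))) (l : 'I_d) :
  ~ countable [set z.1 ord0 l | z in F] ->
  exists Z : set (V * (nat -> nat)),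
  [/\ Z `<=` F, Z !=set0 & forall z r, Z z -> 0 < r ->
    exists z', [/\ Z z', seq_ball r z z' & z'.1 ord0 l <> z.1 ord0 l]].
Proof.
move=> hF; pose h (z : V * (nat -> nat)) := z.1 ord0 l.
pose big b := ~ countable (h @` (rat_box b `&` F)).
pose Z := [set z | F z /\ forall b, rat_box b z -> big b].
(* Every discarded point lies in a box with countable image, and there are countably many boxes. *)
have cZ : countable (h @` (F `\` Z)).
  apply: (@sub_countable _ _ _ (\bigcup_(b in [set b | ~ big b])
      (h @` (rat_box b `&` F)))).
    apply: subset_card_le => _ [z [Fz nZ] <-].
    have [b [bz nb]] : exists b, rat_box b z /\ ~ big b.
      apply: contrapT => hno; apply: nZ; split => // b bz.
      by apply: contrapT => nb; apply: hno; exists b.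
    by exists b => //; exists z.
  apply: bigcup_countable; first exact: countableP.
  by move=> b /contrapT.
(* An uncountable image survives the removal of the discarded points and of one value [y]. *)
have pick (G : set (V * (nat -> nat))) y : G `<=` F -> ~ countable (h @` G) ->
    exists z, [/\ Z z, G z & h z <> y].
  move=> GF hG; apply: contrapT => hno; apply: hG.
  apply: (@sub_countable _ _ _ (\bigcup_(b in [set: bool])
      if b then [set y] else h @` (F `\` Z))); last first.
    by apply: bigcup_countable => // -[].
  apply: subset_card_le => _ [z Gz <-].
  have [->|hzy] := pselect (h z = y); first by exists true.
  exists false => //; exists z => //; split; first exact: GF.
  by move=> Zz; apply: hno; exists z.
exists Z; split.
- by move=> z [].
- by have [z [Zz _ _]] := pick F 0 (fun _ p => p) hF; exists z.
- move=> z r Zz r0; have [b [bz hb]] := rat_box_small z r0.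
  have [_ /(_ b bz) bigb] := Zz.
  have [z' [Zz' [bz' _] ne]] := pick _ (h z) (@subIsetr _ _ _) bigb.
  by exists z'; split => //; exact: hb.
Qed.

End Condensation.

(** * Finite covers by boxes *)

Section ContentZero.
Variables (R : realType) (d : nat).
Local Notation V := 'rV[R]_d.

Definition boxes (s : seq (V * V)) : set V :=
  [set x | exists2 b, b \in s & box b.1 b.2 x].

Definition content_zero (E : set V) : Prop := forall eps : R, 0 < eps ->
  exists s : seq (V * V),
  [/\ forall b, b \in s -> forall i, b.1 ord0 i <= b.2 ord0 i,
      E `<=` boxes s & \sum_(b <- s) box_volume b.1 b.2 <= eps].

Lemma box_volume_ge0 (u v : V) : (forall i, u ord0 i <= v ord0 i) ->
  0 <= box_volume u v.
Proof. by move=> uv; apply: prodr_ge0 => i _; rewrite subr_ge0. Qed.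

Lemma compact_box (u v : V) : compact (box u v).
Proof.
have -> : box u v = [set x | forall i, `[u ord0 i, v ord0 i]%classic (x ord0 i)].
  by apply/seteqP; split => x h i; have := h i; rewrite /= in_itv.
apply: (@rV_compact _ _ (fun i => `[u ord0 i, v ord0 i]%classic)) => i.
exact: segment_compact.
Qed.

Lemma compact_boxes (s : seq (V * V)) : compact (boxes s).
Proof.
rewrite (_ : boxes s = \bigcup_(b in [set` s]) box b.1 b.2)// bigcup_seq.
by apply: bigsetU_compact => b _; exact: compact_box.
Qed.

Lemma content_zero_outer_measure (E : set V) : (0 < d)%N -> content_zero E ->
  lebesgue_outer_measure E = 0%E.
Proof.
move=> d0 hE; apply/eqP; rewrite eq_le; apply/andP; split; last first.
  apply: le_ereal_inf_tmp => _ [u [v [[uv _] ->]]].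
  by apply: nneseries_ge0 => k _ _; rewrite lee_fin box_volume_ge0.
apply/lee_addgt0Pr => eps eps0; rewrite add0e.
have [s [s1 s2 s3]] := hE _ eps0.
(* The finite cover is continued by degenerate boxes, which have volume 0 because d > 0. *)
pose u k := (nth (0, 0) s k).1; pose v k := (nth (0, 0) s k).2.
apply: ge_ereal_inf.
exists (\sum_(0 <= k <oo) (box_volume (u k) (v k))%:E)%E.
  exists u, v; split => //; split.
    move=> k i; have [ks|ks] := ltnP k (size s).
      by apply: s1; apply: mem_nth.
    by rewrite /u /v nth_default.
  move=> x /s2[b bs bx]; exists (index b s) => //.
  by rewrite /u /v nth_index.
have vz k : (size s <= k)%N -> box_volume (u k) (v k) = 0.
  move=> ks; rewrite /u /v nth_default//= /box_volume.
  by rewrite (bigD1 (Ordinal d0))//= subrr mul0r.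
rewrite (@nneseries_split _ _ 0 (size s)); last first.
  move=> k _; rewrite lee_fin; have [ks|/vz -> //] := ltnP k (size s).
  by apply: box_volume_ge0 => i; apply: s1; apply: mem_nth.
rewrite add0n [X in (_ + X)%E]eseries0 ?adde0; last first.
  by move=> k ks _; rewrite vz.
rewrite sumEFin lee_fin; apply: le_trans s3.
by rewrite [leRHS](big_nth (0, 0)).
Qed.

Lemma content_zero_bigcup (I : finType) (E : I -> set V) :
  (forall i, content_zero (E i)) -> content_zero (\bigcup_i E i).
Proof.
move=> hE eps eps0.
have [I0|I0] := posnP #|I|.
  exists [::]; split => //; last by rewrite big_nil ltW.
  by move=> x [i]; have := card0_eq I0 i; rewrite !inE.
have e0 : 0 < eps / #|I|%:R by rewrite divr_gt0// ltr0n.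
have [s hs] := choice (fun i => hE i _ e0).
exists (flatten [seq s i | i <- enum I]); split.
- move=> b /flatten_mapP[i _ bi]; have [h _ _] := hs i; exact: h.
- move=> x [i _ Ei]; have [_ h _] := hs i; have [b bs bx] := h _ Ei.
  by exists b => //; apply/flatten_mapP; exists i; rewrite ?mem_enum.
- rewrite big_flatten big_map big_enum /=.
  apply: (@le_trans _ _ (\sum_(i : I) eps / #|I|%:R)).
    by apply: ler_sum => i _; have [] := hs i.
  rewrite sumr_const -[leLHS]mulr_natr divfK// pnatr_eq0 -lt0n//.
Qed.

Lemma compact_bigcup (I : finType) (E : I -> set V) :
  (forall i, compact (E i)) -> compact (\bigcup_i E i).
Proof.
move=> hE; rewrite (_ : setT = [set` enum I]); last first.
  by apply/seteqP; split => // i _ /=; rewrite mem_enum.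
by rewrite bigcup_seq; apply: bigsetU_compact => i _; exact: hE.
Qed.

Lemma limit_of_tails (x : nat -> V) (r : nat -> R) :
  (forall n j, `|x (n + j)%N - x n| <= r n) ->
  (forall e, 0 < e -> exists n, r n <= e) ->
  exists a, forall n, `|a - x n| <= r n.
Proof.
move=> hx hr.
have tail n m : (n <= m)%N -> `|x m - x n| <= r n.
  by move=> nm; rewrite -(subnKC nm); exact: hx.
have : cvg (x @ \oo).
  apply/cauchy_cvgP/cauchy_exP => e e0.
  have [n rn] := hr _ (divr_gt0 e0 (ltr0Sn R 1)).
  exists (x n); suff : \forall m \near \oo, ball (x n) e (x m) by [].
  near=> m; rewrite /= -ball_normE /= distrC.
  apply: (@le_lt_trans _ _ (e / 2)); last by rewrite ltr_pdivrMr// ltr_pMr// ltr1n.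
  apply: le_trans _ rn; apply: tail; near: m; exact: nbhs_infty_ge.
move=> /cvg_ex[a xa]; exists a => n; apply/ler_addgt0Pr => e e0.
have /cvgrPdist_le/(_ e e0) xe := xa.
near \oo => m; rewrite -(subrKA (x m)) (le_trans (ler_normD _ _))// addrC.
rewrite lerD//; last by near: m.
by apply: tail; near: m; exact: nbhs_infty_ge.
Unshelve. all: by end_near. Qed.

End ContentZero.

(** * The limit construction *)

Section Refinement.
Variables (R : realType) (T : Type) (Z : set T) (B : R -> T -> T -> Prop).
Variables (pa pb : T -> R) (z0 : T).

(** [st_dl] is the thickness of the current sweep; [st_eta] bounds the displacement that led to the
    state. *)
Record state := State {
  st_N : nat; st_z : nat -> T; st_dl : R; st_eta : R }.

Definition valid (s : state) : Prop :=
  [/\ (0 < st_N s)%N, forall f, Z (st_z s f), 0 < st_dl s & 0 < st_eta s].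

(** Halving [st_eta] and keeping it below half of the previous [st_dl] makes all later displacements
    add up to at most that thickness. *)
Definition refines (n : nat) (s s' : state) : Prop :=
  exists2 k, (0 < k)%N &
  [/\ st_N s' = (st_N s * k)%N,
      forall f, B (st_eta s') (st_z s (f %/ k)%N) (st_z s' f),
      st_eta s' <= st_eta s / 2, st_eta s' <= st_dl s / 2 &
      sq_cover n.+1%:R^-1 (swept pa pb (@segment_times R) (st_N s') (st_z s') (st_dl s'))].

Lemma refinement_sequence : perfect_system Z B pa pb -> Z z0 ->
  exists s : nat -> state,
  [/\ s 0%N = State 1 (fun=> z0) 1 1, forall n, valid (s n) &
      forall n, refines n (s n) (s n.+1)].
Proof.
move=> ps Zz0.
have next (p : nat * {s | valid s}) :
    exists s' : {s | valid s}, refines p.1 (proj1_sig p.2) (proj1_sig s').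
  case: p => n [[N z dl eta] [/= N0 hz dl0 eta0]] /=.
  have [eta' [eta'0 h1 h2 _ _]] := exists_pos_le4
    (divr_gt0 eta0 (ltr0Sn R 1)) (divr_gt0 dl0 (ltr0Sn R 1)) ltr01 ltr01.
  have n0 : 0 < n.+1%:R^-1 :> R by rewrite invr_gt0.
  have [k [z' [dl' [k0 hz' hB dl'0 hc]]]] := refine_cover ps n0 N0 hz eta'0.
  have v : valid (State (N * k) z' dl' eta') by split => //=; rewrite muln_gt0 N0.
  by exists (exist _ _ v), k.
have [g hg] := choice next.
have v0 : valid (State 1 (fun=> z0) 1 1) by split => //=; exact: ltr01.
pose s := fix s n := if n is n'.+1 then g (n', s n') else exist _ _ v0.
exists (fun n => proj1_sig (s n)); split => // n; first exact: proj2_sig.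
exact: (hg (n, s n)).
Qed.

(** Along the nested intervals containing [u] the centres form a Cauchy sequence that never leaves
    the thickness of any earlier stage. *)
Lemma refinement_branch (s : nat -> state) (u : R) : perfect_system Z B pa pb ->
  0 <= u < 1 -> s 0%N = State 1 (fun=> z0) 1 1 -> (forall n, valid (s n)) ->
  (forall n, refines n (s n) (s n.+1)) ->
  let c n := st_z (s n) (idx (st_N (s n)) u) in
  exists r : nat -> R,
  [/\ c 0%N = z0, forall n, Z (c n),
     forall n j, B (r n) (c n) (c (n + j)%N),
     forall n, r n <= st_dl (s n) & forall n, r n <= (2 ^+ n)^-1].
Proof.
move=> ps /andP[u0 u1] s0 vs rs c.
pose eta n := st_eta (s n).
have eta_pos n : 0 < eta n by have [] := vs n.
have eta_half n : eta n.+1 <= eta n / 2 by have [k _ []] := rs n.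
have eta_dl n : eta n.+1 <= st_dl (s n) / 2 by have [k _ []] := rs n.
have etaX n : eta n <= (2 ^+ n)^-1.
  elim: n => [|n IH]; first by rewrite /eta s0 expr0 invr1.
  by have := eta_half n; rewrite exprSr invfM; lra.
have cB n : B (eta n.+1) (c n) (c n.+1).
  have [k k0 [Nk hB _ _ _]] := rs n.
  have := hB (idx (st_N (s n.+1)) u).
  by rewrite {1}Nk idx_div.
exists (fun n => 2 * eta n.+1); split.
- by rewrite /c s0.
- by move=> n; have [_ h _ _] := vs n; exact: h.
(* The sharper, telescoping bound makes the induction on [j] work. *)
- move=> n j; apply: (ps_mono ps (r := 2 * (eta n.+1 - eta (n + j).+1))).
    by rewrite ler_pM2l// gerBl ltW.
  elim: j => [|j IH].
    by rewrite addn0 subrr mulr0; exact: (ps_refl ps).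
  have := ps_trans ps IH (cB (n + j)%N); rewrite addnS; apply: (ps_mono ps).
  by have := eta_half (n + j).+1; lra.
- by move=> n; have := eta_dl n; lra.
- move=> n; apply: le_trans (etaX n); have := eta_half n; lra.
Qed.

End Refinement.

(** * From planar covers to one face of directions *)

Section Face.
Variables (R : realType) (d : nat).
Local Notation V := 'rV[R]_d.
Local Notation T := (V * (nat -> nat))%type.

Lemma coord_norm_le (x : V) i : `|x ord0 i| <= `|x|.
Proof. by have /row_norm_leP := lexx `|x|; apply. Qed.

(* The factor 1/4 turns the slopes [-1, 1] into a subinterval of [-1/2, 1/2]. *)
Definition plane_a (o : V) (i : 'I_d) (z : T) : R := z.1 ord0 i - o ord0 i + 2.
Definition plane_b (o : V) (l : 'I_d) (z : T) : R :=
  (z.1 ord0 l - o ord0 l) / 4 + 2.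

(** The box over a planar square, obtained by inverting [plane_a] and [plane_b]. The other
    coordinates get a range of 2 around [o]: 1 for the centre and 1/2 for the segment are enough. *)
Definition cylinder (o : V) (i l : 'I_d) (b : R * R * R) : V * V :=
  (\row_j (if j == i then b.1.1 - 2 + o ord0 i
           else if j == l then 4 * (b.1.2 - 2) + o ord0 l else o ord0 j - 2),
   \row_j (if j == i then b.1.1 + b.2 - 2 + o ord0 i
           else if j == l then 4 * (b.1.2 + b.2 - 2) + o ord0 l
           else o ord0 j + 2)).

Lemma cylinder_le o i l b j : 0 <= b.2 ->
  (cylinder o i l b).1 ord0 j <= (cylinder o i l b).2 ord0 j.
Proof. by move=> b0; rewrite !mxE; case: eqP => _; [|case: eqP => _]; lra. Qed.

Definition cylinder_const (i l : 'I_d) : R :=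
  4 * \prod_(j < d | (j != i) && (j != l)) 4.

Lemma cylinder_volume o i l b : i != l ->
  box_volume (cylinder o i l b).1 (cylinder o i l b).2 =
  cylinder_const i l * b.2 ^+ 2.
Proof.
move=> il; rewrite /box_volume (bigD1 i)//= (bigD1 l)/= ?(eq_sym l)//.
rewrite !mxE eqxx eq_sym (negPf il) eqxx.
rewrite (eq_bigr (fun=> 4)); last first.
  by move=> j /andP[/negPf ji /negPf jl]; rewrite !mxE ji jl; ring.
by rewrite /cylinder_const; ring.
Qed.

(** The unit ball around [z0] keeps the planar centres in [1, 3]^2, and being open it contains the
    nearby centres. Since [l0] is one of the two planar coordinates, they remain distinct in the
    plane. *)
Lemma perfect_system_plane (Z : set T) (z0 : T) (i l l0 : 'I_d) :
  (l0 = i \/ l0 = l) ->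
  (forall z r, Z z -> 0 < r -> exists z',
    [/\ Z z', seq_ball r z z' & z'.1 ord0 l0 <> z.1 ord0 l0]) ->
  perfect_system [set z | Z z /\ `|z.1 - z0.1| < 1] (@seq_ball R d)
    (plane_a z0.1 i) (plane_b z0.1 l).
Proof.
move=> hl hZ; split.
- by move=> r z; exact: seq_ball_refl.
- by move=> r s x y z; exact: seq_ball_trans.
- by move=> r s x y; exact: seq_ball_mono.
- move=> r x y [xy _]; have := coord_norm_le (y.1 - x.1) i.
  rewrite !mxE /plane_a => h.
  rewrite (_ : _ - _ = y.1 ord0 i - x.1 ord0 i); last by ring.
  exact: le_trans xy.
- move=> r x y [xy _]; have := coord_norm_le (y.1 - x.1) l.
  rewrite !mxE /plane_b => h.
  rewrite (_ : _ - _ = (y.1 ord0 l - x.1 ord0 l) / 4); last by field.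
  rewrite normrM (ger0_norm (_ : 0 <= 4^-1))//.
  have r0 := le_trans (normr_ge0 _) xy; have {h} h := le_trans h xy.
  by rewrite ler_pdivrMr//; lra.
- move=> z [_ /ltW hz]; have := coord_norm_le (z.1 - z0.1).
  rewrite /plane_a /plane_b => h.
  have /ler_normlP[i1 i2] := le_trans (h i) hz.
  have /ler_normlP[l1 l2] := le_trans (h l) hz.
  rewrite !mxE in i1 i2 l1 l2.
  by split; apply/andP; split; lra.
- move=> r z r0 [Zz hz].
  have h0 : 0 < 1 - `|z.1 - z0.1| by rewrite subr_gt0.
  have [e [e0 e1 e2 _ _]] := exists_pos_le4 r0
    (divr_gt0 h0 (ltr0Sn R 1)) ltr01 ltr01.
  have [z' [Zz' Bz' ne]] := hZ z e Zz e0.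
  exists z'; split; first 1 last.
  + exact: seq_ball_mono Bz'.
  + rewrite /plane_a /plane_b => -[ea eb]; apply: ne.
    by case: hl => ->; lra.
  + split => //; rewrite -(subrKA z.1) (le_lt_trans (ler_normD _ _))//.
    by have [h _] := Bz'; lra.
Qed.

Lemma invX2_le n : (2 ^+ n)^-1 <= n.+1%:R^-1 :> R.
Proof. by rewrite lef_pV2 ?posrE ?exprn_gt0// -natrX ler_nat ltn_expl. Qed.

Lemma slope_set (A : set V) (F : V -> (nat -> nat) -> Prop) (Z : set T) (z0 : T)
    (i l l0 : 'I_d) :
  pclosed F -> (forall x s, F x s -> A x) -> (forall z, Z z -> F z.1 z.2) -> Z z0 ->
  (forall z r, Z z -> 0 < r -> exists z',
    [/\ Z z', seq_ball r z z' & z'.1 ord0 l0 <> z.1 ord0 l0]) ->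
  i != l -> (l0 = i \/ l0 = l) ->
  exists E : set V,
  [/\ compact E, content_zero E & forall e : V, e ord0 i = 1 ->
    (forall j, `|e ord0 j| <= 1) -> exists2 a, A a &
      forall t, `|t| <= 1 / 2 -> E (a + t *: e)].
Proof.
move=> cF FA ZF Zz0 hZ il hl.
have ps := perfect_system_plane z0 hl hZ.
set Z1 := [set z | _] in ps.
have Z1z0 : Z1 z0 by split => //; rewrite subrr normr0.
have [s [s0 vs rs]] := refinement_sequence ps Z1z0.
pose o := z0.1.
have hsq n : exists q : seq (R * R * R),
  [/\ forall b, b \in q -> 0 <= b.2,
      forall p, swept (plane_a o i) (plane_b o l) (@segment_times R)
          (st_N (s n.+1)) (st_z (s n.+1)) (st_dl (s n.+1)) p ->
        exists2 b, b \in q &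
        b.1.1 <= p.1 <= b.1.1 + b.2 /\ b.1.2 <= p.2 <= b.1.2 + b.2 &
      \sum_(b <- q) b.2 ^+ 2 <= n.+1%:R^-1].
  by have [k _ [_ _ _ _]] := rs n.
have [q hq] := choice hsq.
pose G n := boxes [seq cylinder o i l b | b <- q n].
exists (\bigcap_n G n); split.
- apply: (@subclosed_compact _ _ (G 0%N)); last by move=> x; apply.
    apply: closed_bigI => n _; apply: compact_closed; last exact: compact_boxes.
    exact: norm_hausdorff.
  exact: compact_boxes.
- move=> eps eps0.
  have C0 : 0 < cylinder_const i l.
    by rewrite mulr_gt0// prodr_gt0.
  have [n [n0 hn _ _ _]] := exists_nat_ge4 (cylinder_const i l / eps) 0 0 0.
  have [q1 _ q3] := hq n.
  exists [seq cylinder o i l b | b <- q n]; split.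
  + by move=> _ /mapP[b bq ->] j; apply: cylinder_le; exact: q1.
  + by move=> x /(_ n I).
  + rewrite big_map.
    under eq_bigr do rewrite cylinder_volume//.
    rewrite -big_distrr /=.
    apply: (@le_trans _ _ (cylinder_const i l * n.+1%:R^-1)).
      by rewrite ler_pM2l.
    rewrite ler_pdivrMr// mulrC -ler_pdivrMr//; apply: le_trans hn _.
    by rewrite ler_nat.
move=> e ei he.
(* The planar slope of [e] is [e ord0 l / 4]. *)
pose u := e ord0 l / 4 + 1 / 2.
have hu : 0 <= u < 1.
  by have /ler_normlP[? ?] := he l; rewrite /u; apply/andP; split; lra.
pose c n := st_z (s n) (idx (st_N (s n)) u).
have [r [c0 Zc Bc rdl r2]] : exists r : nat -> R,
    [/\ c 0%N = z0, forall n, Z1 (c n), forall n j, seq_ball (r n) (c n) (c (n + j)%N),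
      forall n, r n <= st_dl (s n) & forall n, r n <= (2 ^+ n)^-1].
  exact: (refinement_branch ps hu s0 vs rs).
have [a ha] : exists a : V, forall n, `|a - (c n).1| <= r n.
  apply: limit_of_tails; first by move=> n j; have [] := Bc n j.
  move=> eps eps0; have [n [n0 hn _ _ _]] := exists_nat_ge4 eps^-1 0 0 0.
  exists n; rewrite (le_trans (r2 n))// (le_trans (invX2_le n))//.
  by rewrite invf_ple ?posrE// (le_trans hn)// ler_nat.
have r01 : r 0%N <= 1 by have := rdl 0%N; rewrite s0.
exists a.
  (* The limit in N^N: entry [j] is constant from stage j + 1 on, as r (j + 1) <= 1/(j + 2) < 1/(j +
     1). Closedness then puts the limit centre in [A]. *)
  apply: (FA _ (fun j => (c j.+1).2 j)); apply: cF => L.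
  exists (c L.+1).1, (c L.+1).2; split.
  - by apply: ZF; have [] := Zc L.+1.
  - rewrite distrC (le_trans (ha _))// (le_trans (r2 _))//.
    apply: le_trans (invX2_le _) _.
    by rewrite lef_pV2 ?posrE// ler_nat.
  - move=> j jL; have [_ h] := Bc j.+1 (L - j)%N.
    have := h j; rewrite addSn subnKC 1?ltnW// => -> //.
    apply: le_lt_trans (r2 _) _.
    apply: le_lt_trans (invX2_le _) _.
    by rewrite ltf_pV2 ?posrE// ltr_nat.
move=> t ht n _.
have [_ q2 _] := hq n.
set v := a + t *: e.
pose p := (a ord0 i + t - o ord0 i + 2, (a ord0 l + t * e ord0 l - o ord0 l) / 4 + 2).
have hdl j : `|a ord0 j - (c n.+1).1 ord0 j| <= st_dl (s n.+1).
  have := coord_norm_le (a - (c n.+1).1) j; rewrite !mxE => h.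
  by rewrite (le_trans h)// (le_trans (ha _)).
have [|b bq [/andP[b1 b2] /andP[b3 b4]]] := q2 p.
  (* The distance from the limit centre to the stage centre is treated as the perturbation allowed
     by the thickness. *)
  exists u, t, (a ord0 i - (c n.+1).1 ord0 i), ((a ord0 l - (c n.+1).1 ord0 l) / 4).
  split; [by []|by []|exact: hdl| |].
    rewrite normrM (ger0_norm (_ : 0 <= 4^-1))// ler_pdivrMr//.
    have := hdl l; have := normr_ge0 (a ord0 l - (c n.+1).1 ord0 l); lra.
  by rewrite -/(c n.+1) /p /plane_a /plane_b /u; congr pair; field.
exists (cylinder o i l b); first by apply/mapP; exists b.
move=> j; rewrite !mxE /= /v.
have [->|ji] := eqVneq j i.
  by rewrite ei; move: b1 b2; rewrite /p /=; lra.
have [->|jl] := eqVneq j l.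
  by move: b3 b4; rewrite /p /=; lra.
have hj := coord_norm_le (a - o) j.
have ho : `|a - o| <= 1 by rewrite /o -c0 (le_trans (ha 0%N)).
have := le_trans hj ho; rewrite !mxE => {hj ho} /ler_normlP[y1 y2].
have : `|t * e ord0 j| <= 1 / 2 * 1 by rewrite normrM ler_pM.
by move=> /ler_normlP[? ?]; apply/andP; split; lra.
Qed.

End Face.

(** * Unit directions and the union over the faces *)

Section UnitVectors.
Variables (R : realType) (d : nat).

(** As |e_i| <= 1, the unit segment along [e] is part of the segment along e / e_i, which has e_i =
    1; a negative e_i only reverses it. *)
Lemma unit_segment_scale (a e : 'rV[R]_d) (E : set 'rV[R]_d) (i : 'I_d) :
  unit_sphere R d e -> e ord0 i != 0 ->
  (forall t, `|t| <= 1 / 2 -> E (a + t *: ((e ord0 i)^-1 *: e))) ->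
  unit_segment a e `<=` E.
Proof.
move=> e1 ei hE _ [t ht <-]; have {ht} /andP[t1 t2] : - (1 / 2) <= t <= 1 / 2.
  by move: ht; rewrite /= in_itv.
rewrite (_ : t *: e = (t * e ord0 i) *: ((e ord0 i)^-1 *: e)); last first.
  by rewrite scalerA mulfK.
apply: hE; rewrite -[leRHS]mulr1 normrM ler_pM// ?ler_norml ?t1//.
have e2 : \sum_(j < d) e ord0 j ^+ 2 = 1.
  move: e1; rewrite /unit_sphere /euclidean_norm /= => /(congr1 (fun x => x ^+ 2)).
  by rewrite sqr_sqrtr ?expr1n// sumr_ge0// => j _; rewrite sqr_ge0.
have : e ord0 i ^+ 2 <= 1.
  by rewrite -e2 (bigD1 i)//= lerDl sumr_ge0// => j _; rewrite sqr_ge0.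
by rewrite -ler_norml -real_normK ?num_real// expr_le1.
Qed.

Lemma unit_max_coordinate (e : 'rV[R]_d) : unit_sphere R d e ->
  exists i : 'I_d, e ord0 i != 0 /\ forall j, `|e ord0 j| <= `|e ord0 i|.
Proof.
move=> e1; have [i0 ei0] : exists i : 'I_d, e ord0 i != 0.
  apply: contrapT => h; move: e1; rewrite /unit_sphere /euclidean_norm /=.
  rewrite big1 ?sqrtr0; first by move/esym/eqP; rewrite oner_eq0.
  move=> i _; apply/eqP; rewrite sqrf_eq0; apply/negP => /negP ei.
  by apply: h; exists i.
case: (@Order.TotalTheory.arg_maxP _ _ _ i0 predT (fun i => `|e ord0 i|) isT) => i _ hi.
exists i; split; last by move=> j; exact: hi.
by rewrite -normr_gt0 (lt_le_trans _ (hi i0 isT))// normr_gt0.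
Qed.

End UnitVectors.

Theorem theorem1p1 (R : realType) (d : nat) (hd : (2 <= d)%N)
    (A : set 'rV[R]_d) (hA : borel_set A) (hAunc : ~ countable A) :
  exists E : set 'rV[R]_d,
    [/\ compact E,
        lebesgue_outer_measure E = 0%E &
        forall e : 'rV[R]_d, unit_sphere R d e ->
          exists2 a : 'rV[R]_d, A a & unit_segment a e `<=` E].
Proof.
have [F [cF AF]] := borel_suslin hA.
have [l0 hl0] := uncountable_coordinate hAunc.
have [|Z [ZF [z0 Zz0] hZ]] := @condensation R d [set z | F z.1 z.2] l0.
  suff -> : [set z.1 ord0 l0 | z in [set z : 'rV[R]_d * (nat -> nat) | F z.1 z.2]] =
    [set x ord0 l0 | x in A] by [].
  apply/seteqP; split => _ [x Fx <-].
    by exists x.1 => //; apply/AF; exists x.2.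
  by have /AF[s Fs] := Fx; exists (x, s).
have FA x s : F x s -> A x by move=> Fx; apply/AF; exists s.
have face (i : 'I_d) : exists E : set 'rV[R]_d,
    [/\ compact E, content_zero E & forall e : 'rV[R]_d, e ord0 i = 1 ->
      (forall j, `|e ord0 j| <= 1) -> exists2 a, A a &
        forall t, `|t| <= 1 / 2 -> E (a + t *: e)].
  (* The plane must contain the coordinate [l0] in which nearby centres differ; if this is [i]
     itself, any second coordinate will do, and d >= 2 supplies one. *)
  have [l il hl] : exists2 l, i != l & l0 = i \/ l0 = l.
    have [<-|il0] := eqVneq i l0; last by exists l0 => //; right.
    case: d hd i {A hA hAunc F cF AF l0 hl0 Z ZF z0 Zz0 hZ FA} => [|[|d']]// _ i.
    by exists (lift i ord0); [exact: neq_lift|left].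
  exact: (slope_set cF FA ZF Zz0 hZ il hl).
(* One set for each index of a largest coordinate; their finite union serves all directions. *)
have [E hE] := choice face.
exists (\bigcup_i E i); split.
- by apply: compact_bigcup => i; have [] := hE i.
- apply: content_zero_outer_measure; first exact: leq_trans hd.
  by apply: content_zero_bigcup => i; have [] := hE i.
move=> e e1; have [i [ei hi]] := unit_max_coordinate e1.
have [_ _ /(_ ((e ord0 i)^-1 *: e))[||a Aa aE]] := hE i.
- by rewrite mxE mulVf.
- by move=> j; rewrite mxE normrM normfV ler_pdivrMl ?normr_gt0// mulr1.
by exists a => //; apply: (unit_segment_scale e1 ei) => t /aE Et; exists i.
Qed.
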